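(* Let $N\ge2$, $R>0$, $\Omega=B(0,R)\subset\mathbb{R}^N$ and let $g\in L^2(\Omega)$ be radial. For $\lambda\ge0$ let $z_\lambda$ be the minimizer of the dual problem $$\inf_{z\in A_\lambda}\ \int_{B(0,R)}\bigl(\operatorname{div}(z)+g\bigr)^2\,dx .$$ Then for any reals $\mu>\lambda\ge0$, $$\{|z_\lambda|<\lambda\}\subset\{|z_\mu|<\mu\}.$$
   Context: For $\lambda\ge0$, $A_\lambda$ is the set of radial vector fields $z(x)=\tilde z(|x|)\frac{x}{|x|}$, $x\neq0$, with $\tilde z\in W^{1,2}(0,R)$, $\tilde z(R)=0$ and $|\tilde z|\le\lambda$ on $(0,R)$. The minimizer $z_\lambda$ has profile $\tilde z_\lambda$, which is continuous by Sobolev embedding, and $|z_\lambda(x)|=|\tilde z_\lambda(|x|)|$. *)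

(* Defs.v *)
From HB Require Import structures.
From mathcomp Require Import all_boot all_order all_algebra.
From mathcomp Require Import all_classical all_reals all_analysis.
Import Order.TTheory GRing.Theory Num.Theory.
Import numFieldNormedType.Exports.

Set Implicit Arguments.
Unset Strict Implicit.
Unset Printing Implicit Defensive.

Local Open Scope classical_set_scope.
Local Open Scope ring_scope.

Definition measure_rV_display : measure_display -> measure_display.
Proof. exact. Qed.

(* The product sigma-algebra on row vectors. Over R it is the Borel one. *)
Section measurable_rV.
Context {d} {T : measurableType d}.
Variable n : nat.

Let coors : 'I_n -> 'rV[T]_n -> T := fun i x => x ord0 i.

Let rV_set0 : g_sigma_preimage coors set0.
Proof. exact: sigma_algebra0. Qed.

Let rV_setC A : g_sigma_preimage coors A -> g_sigma_preimage coors (~` A).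
Proof. exact: sigma_algebraC. Qed.

Let rV_bigcup (F : _^nat) : (forall i, g_sigma_preimage coors (F i)) ->
  g_sigma_preimage coors (\bigcup_i (F i)).
Proof. exact: sigma_algebra_bigcup. Qed.

HB.instance Definition _ := @isMeasurable.Build (measure_rV_display d)
  'rV[T]_n (g_sigma_preimage coors) rV_set0 rV_setC rV_bigcup.

End measurable_rV.

Lemma measurable_coord d (T : measurableType d) n (i : 'I_n) :
  measurable_fun [set: 'rV[T]_n] (fun x : 'rV[T]_n => x ord0 i).
Proof.
move=> _ Y mY; rewrite setTI; apply: sub_sigma_algebra => /=.
rewrite -bigcup_seq/=; exists i => /=; first by rewrite mem_index_enum.
by exists Y => //; rewrite setTI.
Qed.

Lemma measurable_fun_rVP d1 d2 (T1 : measurableType d1)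
    (T2 : measurableType d2) n (f : T1 -> 'rV[T2]_n) :
  (forall i, measurable_fun [set: T1] (fun x => f x ord0 i)) ->
  measurable_fun [set: T1] f.
Proof.
move=> mf _ A mA; rewrite setTI.
pose G := [set B : set 'rV[T2]_n | measurable (f @^-1` B)].
suff : (measurable : set (set 'rV[T2]_n)) `<=` G by exact.
apply: smallest_sub.
  split => [|B GB|F GF].
  - by rewrite /G/= preimage_set0.
  - by rewrite /G/= setTD preimage_setC; exact: measurableC.
  - by rewrite /G/= preimage_bigcup; apply: bigcupT_measurable => i; exact: GF.
rewrite -bigcup_seq => B [i /= _ [C mC <-]].
rewrite /G/= setTI -[X in measurable X]setTI -comp_preimage; exact: mf.
Qed.

Section lebesgue_rV.
Context {R : realType}.

Definition cons_rV n (p : measurableTypeR R * 'rV[R]_n) : 'rV[R]_n.+1 :=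
  row_mx (p.1)%:M p.2.

Definition uncons_rV n (x : 'rV[R]_n.+1) : measurableTypeR R * 'rV[R]_n :=
  (x ord0 ord0, \row_j x ord0 (lift ord0 j)).

Lemma cons_rVK n : cancel (@cons_rV n) (@uncons_rV n).
Proof.
move=> [a y]; congr (_, _).
  by rewrite mxE; case: fintype.splitP => // j _; rewrite mxE !ord1 eqxx mulr1n.
apply/rowP => j; rewrite mxE /cons_rV.
rewrite (_ : lift ord0 j = rshift 1 j); last exact/val_inj.
exact: (row_mxEr (a%:M : 'M[R]_1) y ord0 j).
Qed.

Lemma measurable_cons_rV n : measurable_fun setT (@cons_rV n).
Proof.
apply: measurable_fun_rVP => i.
rewrite /cons_rV; under eq_fun do rewrite mxE.
case: fintype.splitP => j _.
  under eq_fun do rewrite mxE !ord1 eqxx/= mulr1n.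
  exact: measurable_fst.
apply: (@measurableT_comp _ _ _ _ _ _ (fun x : 'rV[R]_n => x ord0 j)) => //.
exact: measurable_coord.
Qed.

Lemma measurable_uncons_rV n : measurable_fun setT (@uncons_rV n).
Proof.
apply: measurable_fun_pair; first exact: measurable_coord.
apply: measurable_fun_rVP => i; under eq_fun do rewrite mxE.
exact: measurable_coord.
Qed.

Section cons.
Local Open Scope ereal_scope.
Variables (n : nat) (m : {sigma_finite_measure set 'rV[R]_n -> \bar R}).

Definition lebesgue_cons : set 'rV[R]_n.+1 -> \bar R :=
  pushforward (lebesgue_measure \x m) (@cons_rV n).

Let mu := measure_function_pushforward__canonical__measure_function_Measure
  (lebesgue_measure \x m) (@measurable_cons_rV n).

Let lebesgue_cons0 : lebesgue_cons set0 = 0.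
Proof. exact: (measure0 mu). Qed.

Let lebesgue_cons_ge0 A : 0 <= lebesgue_cons A.
Proof. exact: (measure_ge0 mu). Qed.

Let lebesgue_cons_sigma_additive : semi_sigma_additive lebesgue_cons.
Proof. exact: (@measure_semi_sigma_additive _ _ _ mu). Qed.

HB.instance Definition _ := isMeasure.Build _ _ _ lebesgue_cons
  lebesgue_cons0 lebesgue_cons_ge0 lebesgue_cons_sigma_additive.

Let lebesgue_cons_sigma_finite : sigma_finite setT lebesgue_cons.
Proof.
have /sigma_finiteP[F [FT ndF Ffin]] := sigma_finiteT (@lebesgue_measure R).
have /sigma_finiteP[G [GT ndG Gfin]] := sigma_finiteT m.
exists (fun k => @uncons_rV n @^-1` (F k `*` G k)).
  rewrite -preimage_bigcup -(preimage_setT (@uncons_rV n)); congr (_ @^-1` _).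
  rewrite -setXTT FT GT predeqE => -[x y]; split => [[/= [k _ Fx] [l _ Gy]]|].
    exists (maxn k l) => //; split.
    - by move: x Fx; exact/subsetPset/ndF/leq_maxl.
    - by move: y Gy; exact/subsetPset/ndG/leq_maxr.
  by move=> [k _ []/= Fx Gy]; split; exists k.
move=> k; have [mF Foo] := Ffin k; have [mG Goo] := Gfin k; split.
  rewrite -[X in measurable X]setTI; apply: measurable_uncons_rV => //.
  exact: measurableX.
rewrite /lebesgue_cons /pushforward -comp_preimage.
rewrite (_ : _ \o _ = id) ?preimage_id; last first.
  by apply/funext => x; exact: cons_rVK.
by rewrite product_measure1E// lte_mul_pinfty// ge0_fin_numE.
Qed.

HB.instance Definition _ := Measure_isSigmaFinite.Build _ _ _ lebesgue_cons
  lebesgue_cons_sigma_finite.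

End cons.

(* Lebesgue measure on R^n: the n-fold product of lebesgue_measure. *)
Fixpoint lebesgue_rV n : {sigma_finite_measure set 'rV[R]_n -> \bar R} :=
  if n is n'.+1 then lebesgue_cons (lebesgue_rV n') else \d_(0 : 'rV[R]_0).

End lebesgue_rV.

Section dual_problem.
Context {R : realType}.
Local Notation mu := (@lebesgue_measure R).

(* The norm of the library on row vectors is the sup norm. *)
Definition enorm n (x : 'rV[R]_n) : R := Num.sqrt (\sum_i x ord0 i ^+ 2).

Definition eball n (r : R) : set 'rV[R]_n := [set x | enorm x < r].

Definition L2 d (T : measurableType d) (m : {measure set T -> \bar R})
    (D : set T) (f : T -> R) : Prop :=
  measurable_fun D f /\ (\int[m]_(x in D) (f x ^+ 2)%:E < +oo)%E.

Definition radial n (D : set 'rV[R]_n) (g : 'rV[R]_n -> R) : Prop :=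
  exists gt : R -> R,
    {ae lebesgue_rV n, forall x, D x -> g x = gt (enorm x)}.

Definition compact_support_in (T : topologicalType) (U : set T) (phi : T -> R)
    : Prop :=
  exists K : set T, [/\ compact K, K `<=` U & forall x, ~ K x -> phi x = 0].

(* Weak derivatives and divergences are tested against C^1 functions with
   compact support, which gives the same notions as C^oo ones. *)
Definition C1c (U : set R) (phi : R -> R) : Prop :=
  [/\ forall t : R, derivable phi t 1, continuous (derive1 phi) &
      compact_support_in U phi].

Definition partial n (i : 'I_n) (phi : 'rV[R]_n -> R) (x : 'rV[R]_n) : R :=
  'D_(delta_mx ord0 i) phi x.

Definition C1c_rV n (U : set 'rV[R]_n) (phi : 'rV[R]_n -> R) : Prop :=
  [/\ forall x, differentiable phi x, forall i, continuous (partial i phi) &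
      compact_support_in U phi].

Definition weak_derivative (a b : R) (f h : R -> R) : Prop :=
  forall phi, C1c `]a, b[ phi ->
    \int[mu]_(t in `]a, b[) (f t * derive1 phi t) =
    - \int[mu]_(t in `]a, b[) (h t * phi t).

Definition W12 (a b : R) (f : R -> R) : Prop :=
  L2 mu `]a, b[ f /\
  exists2 h, L2 mu `]a, b[ h & weak_derivative a b f h.

Definition locally_integrable_rV n (U : set 'rV[R]_n) (f : 'rV[R]_n -> R)
    : Prop :=
  measurable_fun U f /\
  forall K, compact K -> K `<=` U ->
    (\int[lebesgue_rV n]_(x in K) `|f x|%:E < +oo)%E.

Definition weak_divergence n (U : set 'rV[R]_n) (z : 'rV[R]_n -> 'rV[R]_n)
    (d : 'rV[R]_n -> R) : Prop :=
  locally_integrable_rV U d /\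
  forall phi, C1c_rV U phi ->
    \int[lebesgue_rV n]_(x in U) (\sum_i z x ord0 i * partial i phi x) =
    - \int[lebesgue_rV n]_(x in U) (d x * phi x).

(* A weak divergence is unique up to null sets and every field of [admissible]
   below has one, so that [xget] only selects a representative. *)
Definition divergence n (U : set 'rV[R]_n) (z : 'rV[R]_n -> 'rV[R]_n)
    : 'rV[R]_n -> R :=
  xget (fun=> 0) [set d | weak_divergence U z d].

Definition dual_energy n (r : R) (g : 'rV[R]_n -> R)
    (z : 'rV[R]_n -> 'rV[R]_n) : \bar R :=
  (\int[lebesgue_rV n]_(x in eball r)
     ((divergence (eball r) z x + g x) ^+ 2)%:E)%E.

(* The set A_lam; the profile [zt] is the continuous representative of its
   Sobolev class, and [z] is unconstrained at the origin. *)
Definition admissible n (r lam : R) (z : 'rV[R]_n -> 'rV[R]_n) : Prop :=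
  exists zt : R -> R,
    [/\ W12 0 r zt, {within `[0, r], continuous zt}, zt r = 0,
        forall t : R, 0 < t < r -> `|zt t| <= lam &
        forall x, eball r x -> x != 0 ->
          z x = zt (enorm x) *: ((enorm x)^-1 *: x)].

Definition dual_minimizer n (r : R) (g : 'rV[R]_n -> R) (lam : R)
    (z : 'rV[R]_n -> 'rV[R]_n) : Prop :=
  admissible r lam z /\
  forall y, admissible r lam y -> (dual_energy r g z <= dual_energy r g y)%E.

End dual_problem.

(* Main.v *)
(** The admissible fields are the [x |-> u(|x|) x/|x|] with [u] a Sobolev profile
of class [W^{1,2}], and [div] acts on profiles as [u |-> u' + (N-1) u/s].  Let [u]
and [v] be the profiles of the minimizers for [mu] and [lam]; the claim follows
from [|u - v| <= mu - lam].  If [u - v > mu - lam] somewhere, then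
[u - v > c(s) := mu - lam + eps s^{1-N}] for a small [eps > 0], on some interval
[(a, b)] with [0 < a] and equality at the ends.  Put [w := (u - v - c)^+]
supported there.  Both [u - w] (for [mu]) and [v + w] (for [lam]) are competitors;
adding the two minimality inequalities gives [int div w (div (u - v) - div w) <= 0].
As [s^{1-N}] has zero divergence, [div (u - v) - div w = (N-1)(mu - lam)/s] where
[w] is nonzero, so that the left-hand side is, up to a positive factor,
[int s^{N-2} (w' + (N-1) w/s) ds = int s^{N-3} w ds > 0].  The barrier [eps s^{1-N}]
keeps [w] away from the origin, where [W^{1,2}] profiles only give weak control.

Polar coordinates are obtained from Tonelli's theorem applied to the dilations
[x |-> s x], without a measure on the sphere. *)

Require Import Defs.
From HB Require Import structures.
From mathcomp Require Import all_boot all_order all_algebra.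
From mathcomp Require Import all_classical all_reals all_analysis.
From mathcomp Require Import measurable_realfun.
From mathcomp Require Import ring lra.
Import Order.TTheory GRing.Theory Num.Theory.
Import numFieldNormedType.Exports.

Set Implicit Arguments.
Unset Strict Implicit.
Unset Printing Implicit Defensive.

Local Open Scope classical_set_scope.
Local Open Scope ring_scope.

(** * Lebesgue measure on row vectors and dilations *)

(** The bound [|u - v| <= mu - lam] suffices because [|v| < lam] then gives
    [|u| <= |v| + (mu - lam) < mu]. Only [u - v <= mu - lam] has to be proved: changing the signs of
    [g] and of the profiles preserves the problem and gives the other half.

    No first variation is taken. With [p = div u + g], [q = div v + g] and [e = div w], moving [w]
    from one field to the other changes the total energy exactly, [(p - e)^2 + (q + e)^2 = p^2 + q^2
    - 2 e (p - q - e)], and [g] cancels from [p - q]. The constraints survive the exchange because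
    [u - w = v + c] and [v + w = u - c] where [w] is nonzero, with [c >= mu - lam].

    Much of the length comes from the energy being written with some representative of the
    distributional divergence. To compute it by the radial formula, the weak derivative of a profile
    must be integrated back to a primitive, the radial formula must be shown to be a weak divergence
    across the singular origin, and weak divergences must be shown to agree almost everywhere. *)

(** The preimage hypothesis says that the pushforward of [m] by [s] is [k] times [m], so this is the
    change of variables for pushforwards. *)
Lemma ge0_integral_comp_scaling d (T : measurableType d) (R : realType)
    (m : {measure set T -> \bar R}) (s : T -> T) (k : R) (u : T -> \bar R) :
  measurable_fun setT s -> 0 <= k ->
  (forall A, measurable A -> m (s @^-1` A) = k%:E * m A)%E ->
  measurable_fun [set: _] u -> (forall x, 0 <= u x)%E ->
  (\int[m]_x u (s x) = k%:E * \int[m]_x u x)%E.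
Proof.
move=> ms k0 sk mu u0.
rewrite -(preimage_setT s) -[LHS]/(integral _ _ (u \o s)).
rewrite -(@ge0_integral_pushforward _ _ _ _ _ s ms m setT u)//.
have -> : (k%:E * \int[m]_x u x = \int[mscale (NngNum k0) m]_x u x)%E.
  by rewrite ge0_integral_mscale.
by apply: eq_measure_integral => A mA _; rewrite /= /mscale/= -sk.
Qed.

Section scaling_R.
Context {R : realType}.
Local Notation mu := (@lebesgue_measure R).

(** By uniqueness of Lebesgue measure: [c] times its pushforward by the dilation has the right value
    on half-open intervals. *)
Lemma lebesgue_measure_scale (c : R) (A : set R) : 0 < c -> measurable A ->
  mu ( *%R c @^-1` A) = (c^-1%:E * mu A)%E.
Proof.
move=> c0 mA.
have mc : measurable_fun [set: measurableTypeR R]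
    ( *%R c : measurableTypeR R -> measurableTypeR R).
  exact: mulrl_measurable.
pose m0 : {measure set (measurableTypeR R) -> \bar R} :=
  measure_function_pushforward__canonical__measure_function_Measure mu mc.
pose k : {nonneg R} := NngNum (ltW c0).
pose m1 : {measure set (measurableTypeR R) -> \bar R} := mscale k m0.
have E : forall B, measurable B -> mu B = m1 B.
  apply: lebesgue_measure_unique => _ [[a b] /= ab <-].
  rewrite /mscale/= /pushforward.
  have -> : *%R c @^-1` `]a, b] = `]a / c, b / c]%classic.
    apply/seteqP; split=> x /=; rewrite !in_itv/=.
      by rewrite ltr_pdivrMr// ler_pdivlMr// mulrC.
    by rewrite ltr_pdivrMr// ler_pdivlMr// mulrC.
  rewrite !lebesgue_measure_itv/= !lte_fin ltr_pM2r ?invr_gt0//.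
  case: ifPn => [_|]; last by rewrite mule0.
  by rewrite -!EFinB -EFinM; congr EFin; field; rewrite gt_eqF.
by rewrite (E A mA) /m1/= /mscale/= /pushforward muleA -EFinM mulVf ?mul1e// gt_eqF.
Qed.

Lemma ge0_integral_scale (c : R) (u : R -> \bar R) : 0 < c ->
  measurable_fun [set: _] u -> (forall x, 0 <= u x)%E ->
  (\int[mu]_x u (c * x)%R = c^-1%:E * \int[mu]_x u x)%E.
Proof.
move=> c0 mu_ u0.
apply: (@ge0_integral_comp_scaling _ (measurableTypeR R) _ mu ( *%R c) c^-1) => //.
- by rewrite invr_ge0 ltW.
- by move=> A mA; exact: lebesgue_measure_scale.
Qed.

End scaling_R.

Section lebesgue_rV_scaling.
Context {R : realType}.
Local Notation mu := (@lebesgue_measure R).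
Local Notation lr := (@lebesgue_rV R).

Lemma measurable_scale_rV n (c : R) :
  measurable_fun [set: 'rV[R]_n] (fun x : 'rV[R]_n => c *: x).
Proof.
apply: measurable_fun_rVP => i; under eq_fun do rewrite mxE.
by apply: measurable_funM => //; exact: measurable_coord.
Qed.

(** Induction by slicing: the slice at [t] of the dilated preimage is the dilated preimage of the
    slice at [c * t]. The induction hypothesis contributes [c^-n] and the outer variable one more
    factor [c^-1]. *)
Lemma lebesgue_rV_scale n (c : R) (A : set 'rV[R]_n) : 0 < c ->
  measurable A ->
  lr n ((fun x => c *: x) @^-1` A) = ((c ^- n)%:E * lr n A)%E.
Proof.
move=> c0; elim: n A => [|n IH] A mA.
  rewrite expr0 invr1 mul1e; congr (lr 0 _).
  by apply/seteqP; split => x /=; rewrite (thinmx0 x) (thinmx0 (_ *: _)).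
rewrite /= /lebesgue_cons /pushforward.
set B := @cons_rV R n @^-1` A.
have mB : measurable B.
  by rewrite -[B]setTI; exact: measurable_cons_rV.
have mS : measurable_fun setT (fun x => lr n (xsection B x)).
  exact: measurable_fun_xsection.
rewrite /product_measure1.
under eq_integral => t _.
  rewrite /=.
  have -> : xsection (@cons_rV R n @^-1` ((fun x => c *: x) @^-1` A)) t
     = (fun y => c *: y) @^-1` xsection B (c * t).
    have E y : c *: cons_rV (t, y) = cons_rV (c * t, c *: y).
      by apply: etrans (scale_row_mx c (t%:M : 'M[R]_1) y) _; rewrite scale_scalar_mx.
    by apply/seteqP; split => y; rewrite /xsection/= !inE/= /B/= E.
  rewrite IH; last exact: measurable_xsection.
  over.
rewrite /= ge0_integralZl//; last 2 first.
- by apply: (@measurableT_comp _ _ _ _ _ _ (fun x => lr n (xsection B x)) _ ( *%R c)) => //; exact: mulrl_measurable.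
- by rewrite lee_fin invr_ge0 exprn_ge0// ltW.
rewrite (@ge0_integral_scale _ c (fun x => lr n (xsection B x)))//.
by rewrite muleA -EFinM exprSr invfM.
Qed.

Lemma ge0_integral_scale_rV n (c : R) (u : 'rV[R]_n -> \bar R) : 0 < c ->
  measurable_fun [set: _] u -> (forall x, 0 <= u x)%E ->
  (\int[lr n]_x u (c *: x) = (c ^- n)%:E * \int[lr n]_x u x)%E.
Proof.
move=> c0 mu_ u0.
apply: (@ge0_integral_comp_scaling _ _ _ (lr n) (fun x => c *: x) (c ^- n)) => //.
- exact: measurable_scale_rV.
- by rewrite invr_ge0 exprn_ge0// ltW.
- by move=> A mA; exact: lebesgue_rV_scale.
Qed.

(** Being a product, this set has an explicit measure; comparison with it shows that Euclidean balls
    have finite measure and that the measure is not trivial. *)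
Definition cube n : set 'rV[R]_n := [set x | forall i, `|x ord0 i| < 1].
Arguments cube : clear implicits.

Lemma measurable_cube n : measurable (cube n).
Proof.
have -> : cube n = \bigcap_(i in [set: 'I_n])
    ((fun x : 'rV[R]_n => x ord0 i) @^-1` `]-1, 1[).
  apply/seteqP; split => [x /= H i _ /=|x /= H i].
    by rewrite in_itv/= -ltr_norml.
  by have := H i I; rewrite /= in_itv/= -ltr_norml.
apply: fin_bigcap_measurable => // i _.
rewrite -[X in measurable X]setTI.
by apply: (@measurable_coord _ (measurableTypeR R) n i) => //; exact: measurable_itv.
Qed.

Lemma lebesgue_rV_cube n : lr n (cube n) = (2 ^+ n)%:E.
Proof.
elim: n => [|n IH].
  rewrite /= diracE mem_set// => -[//].
rewrite /= /lebesgue_cons /pushforward.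
have -> : @cons_rV R n @^-1` cube n.+1 = `]-1, 1[ `*` cube n.
  apply/seteqP; split => [[t y] /= H|[t y] /= [H1 H2] i].
    rewrite in_itv/= -ltr_norml; split.
      have := H ord0; rewrite mxE; case: fintype.splitP => // j _.
      by rewrite mxE !ord1 eqxx.
    move=> i; have := H (rshift 1 i).
    by rewrite /cons_rV (row_mxEr (t%:M : 'M[R]_1) y).
  rewrite mxE; case: fintype.splitP => j _; last exact: H2.
  by rewrite mxE !ord1 eqxx/= ltr_norml; move: H1; rewrite in_itv.
rewrite product_measure1E//=; last exact: measurable_cube.
rewrite lebesgue_measure_itv/= lte_fin ifT; last by lra.
by rewrite IH -EFinD -EFinM exprS; congr (_ * _)%:E; lra.
Qed.

Lemma enorm_ge0 n (x : 'rV[R]_n) : 0 <= enorm x.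
Proof. exact: sqrtr_ge0. Qed.

Lemma sqr_enorm n (x : 'rV[R]_n) : enorm x ^+ 2 = \sum_i x ord0 i ^+ 2.
Proof. by rewrite sqr_sqrtr// sumr_ge0// => i _; exact: sqr_ge0. Qed.

Lemma enormZ n c (x : 'rV[R]_n) : enorm (c *: x) = `|c| * enorm x.
Proof.
rewrite /enorm; under eq_bigr do rewrite mxE exprMn.
by rewrite -mulr_sumr sqrtrM ?sqr_ge0// sqrtr_sqr.
Qed.

Lemma enorm_eq0 n (x : 'rV[R]_n) : (enorm x == 0) = (x == 0).
Proof.
apply/idP/eqP => [/eqP|->]; last first.
  by rewrite -(scale0r 0) enormZ normr0 mul0r.
move=> e0; have /eqP := sqr_enorm x; rewrite e0 expr0n/= eq_sym psumr_eq0; last first.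
  by move=> i _; exact: sqr_ge0.
move=> /allP xi; apply/rowP => i; rewrite !mxE.
by have := xi i (mem_index_enum _); rewrite sqrf_eq0 => /eqP.
Qed.

Lemma enorm0 n : enorm (0 : 'rV[R]_n) = 0.
Proof. by apply/eqP; rewrite enorm_eq0. Qed.

Lemma enorm_gt0 n (x : 'rV[R]_n) : (0 < enorm x) = (x != 0).
Proof. by rewrite lt_def enorm_ge0 andbT enorm_eq0. Qed.

Lemma coord_le_enorm n (x : 'rV[R]_n) i : `|x ord0 i| <= enorm x.
Proof.
rewrite -(@ler_pXn2r _ 2)// ?nnegrE ?enorm_ge0// sqr_enorm real_normK ?num_real//.
by rewrite (bigD1 i)//= lerDl sumr_ge0// => j _; exact: sqr_ge0.
Qed.

Lemma cube_enorm n (x : 'rV[R]_n) : cube n x -> enorm x < n.+1%:R.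
Proof.
move=> Hx; rewrite -(@ltr_pXn2r _ 2)// ?nnegrE ?enorm_ge0// sqr_enorm.
apply: (@le_lt_trans _ _ (\sum_(i < n) (1 : R))).
  apply: ler_sum => i _; rewrite -[_ ^+ 2]real_normK ?num_real//.
  by rewrite expr_le1// ltW.
rewrite sumr_const card_ord -natrX ltr_nat.
by rewrite expnS expn1 leq_pmull.
Qed.

Lemma measurable_enorm n : measurable_fun setT (@enorm R n).
Proof.
apply: (@measurableT_comp _ _ _ _ _ _ (@Num.sqrt R)) => //.
  by apply: continuous_measurable_fun; exact: sqrt_continuous.
by apply: measurable_sum => i; apply: measurable_funX; exact: measurable_coord.
Qed.

Lemma measurable_eball n (r : R) : measurable (@eball R n r).
Proof.
have -> : @eball R n r = @enorm R n @^-1` `]-oo, r[.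
  by apply/seteqP; split => x /=; rewrite in_itv.
rewrite -[X in measurable X]setTI; apply: measurable_enorm => //.
Qed.

Lemma lebesgue_rV_eball_lty n (r : R) : (lr n (@eball R n r) < +oo)%E.
Proof.
have [r0|r0] := ltP 0 r; last first.
  rewrite (_ : eball r = set0) ?measure0//; apply/seteqP; split => x //=.
  by rewrite /eball/= ltNge (le_trans r0 (enorm_ge0 _)).
have -> : @eball R n r = (fun x => r^-1 *: x) @^-1` eball 1.
  apply/seteqP; split => x /=; rewrite /eball/= enormZ ger0_norm ?invr_ge0 1?ltW//.
    by rewrite mulrC ltr_pdivrMr// mul1r.
  by rewrite mulrC ltr_pdivrMr// mul1r.
rewrite lebesgue_rV_scale ?invr_gt0//; last exact: measurable_eball.
apply: (@le_lt_trans _ _ (((r^-1) ^- n)%:E * lr n (cube n))%E).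
  apply: lee_pmul => //; first by rewrite lee_fin invr_ge0 exprn_ge0// invr_ge0 ltW.
  apply: le_measure; rewrite ?inE; [exact: measurable_eball|exact: measurable_cube|].
  by move=> x /= xb i; apply: le_lt_trans xb; exact: coord_le_enorm.
by rewrite lebesgue_rV_cube -EFinM ltry.
Qed.

End lebesgue_rV_scaling.

(** * Measurability for the product sigma-algebra *)

Section measurability.
Context {R : realType}.

(** An open set is a countable union of cubes with rational centers and radii [1/(k+1)], and each
    cube is a finite intersection of coordinate strips. *)
Lemma open_measurable_rV n (O : set 'rV[R]_n) : open O -> measurable O.
Proof.
move=> oO.
pose C (p : 'rV[rat]_n * nat) : set 'rV[R]_n :=
  [set x | forall i, `|x ord0 i - ratr (p.1 ord0 i)| < p.2.+1%:R^-1].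
(* Cubes that leave [O] are replaced by the empty set, so that the union ranges over a whole
   countable type. *)
pose D p : set 'rV[R]_n := if `[< C p `<=` O >] then C p else set0.
have -> : O = \bigcup_p D p.
  apply/seteqP; split => [x Ox|x [p _]]; last first.
    by rewrite /D; case: asboolP => // + Cx; exact.
  have /nbhs_ballP[e /= e0 xeO] := oO x Ox.
  have [k ke] : exists k : nat, k.+1%:R^-1 < e / 2.
    have e2 : 0 < e / 2 by rewrite divr_gt0.
    have [k _ /(_ k (leqnn k)) ke] := near_infty_natSinv_lt (PosNum e2).
    by exists k.
  have /choice[q Hq] : forall i, exists q : rat,
      ratr q \in `]x ord0 i - k.+1%:R^-1, x ord0 i + k.+1%:R^-1[.
    by move=> i; apply: rat_in_itvoo; rewrite ltrD2l gtrN// invr_gt0.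
  have qx i : `|x ord0 i - ratr ((\row_j q j) ord0 i)| < k.+1%:R^-1.
    by rewrite mxE distrC; have := Hq i; rewrite in_itv/= ltr_distl.
  exists (\row_i q i, k) => //; rewrite /D asboolT// => y /= Cy.
  apply: xeO; split=> // i j; rewrite ord1 /ball/=.
  apply: le_lt_trans (ler_distD (ratr (q j)) _ _) _.
  rewrite [e]splitr; apply: ltrD; apply: lt_trans ke.
    by have := qx j; rewrite mxE.
  by have := Cy j; rewrite mxE distrC.
apply: countable_bigcupT_measurable => [|p].
  exact: countableP.
rewrite /D; case: ifP => _; last exact: measurable0.
have -> : C p = \bigcap_(i in [set: 'I_n]) ((fun x : 'rV[R]_n => x ord0 i) @^-1`
    `]ratr (p.1 ord0 i) - p.2.+1%:R^-1, ratr (p.1 ord0 i) + p.2.+1%:R^-1[).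
  apply/seteqP; split => [x /= H i _ /=|x /= H i].
    by rewrite in_itv/= -ltr_distl.
  by have := H i I; rewrite /= in_itv/= -ltr_distl.
apply: fin_bigcap_measurable => // i _.
rewrite -[X in measurable X]setTI.
by apply: (@measurable_coord _ (measurableTypeR R) n i) => //; exact: measurable_itv.
Qed.

Lemma compact_measurable_rV n (K : set 'rV[R]_n) : compact K -> measurable K.
Proof.
move=> cK; have clK : closed K.
  by apply: compact_closed => //; exact: norm_hausdorff.
rewrite -(setCK K); apply: measurableC; apply: open_measurable_rV.
by rewrite openC.
Qed.

Lemma continuous_measurable_rV n (f : 'rV[R]_n -> R) : continuous f ->
  measurable_fun [set: 'rV[R]_n] f.
Proof.
move=> /continuousP cf; apply: (measurability _ (RGenOpens.measurableE R)).
move=> _ [_ [a [b ->] <-]]; rewrite setTI; apply: open_measurable_rV.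
exact/cf/interval_open.
Qed.

Lemma measurable_invr : measurable_fun [set: R] (fun x : R => x^-1).
Proof.
rewrite -(setUv [set (0 : R)]); apply/measurable_funU; first exact: measurable_set1.
  by apply: measurableC; exact: measurable_set1.
split; first exact: measurable_fun_set1.
apply: open_continuous_measurable_fun.
  by rewrite openC; exact: closed_eq.
by move=> x; rewrite inE/= => /eqP x0; exact: inv_continuous.
Qed.

Lemma measurable_scale_pair n :
  measurable_fun [set: measurableTypeR R * 'rV[R]_n]
    (fun p : measurableTypeR R * 'rV[R]_n => (p.1 : R) *: p.2).
Proof.
apply: measurable_fun_rVP => i; under eq_fun do rewrite mxE.
apply: measurable_funM; first exact: measurable_fst.
by apply: (@measurableT_comp _ _ _ _ _ _ (fun x : 'rV[R]_n => x ord0 i)) => //;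
  exact: measurable_coord.
Qed.

End measurability.

(** * Integration along rays *)

Section polar.
Context {R : realType}.
Local Notation mu := (@lebesgue_measure R).

(* Averaging over the shell [1 < |x| < 2] in logarithmic scale replaces the
   disintegration over spheres. *)
Lemma integral_inv_dyadic : exists2 k : R, 0 < k & forall t : R, 0 < t ->
  (\int[mu]_s (if (s < t) && (t < 2 * s) then s^-1 else 0)%:E = k%:E)%E.
Proof.
pose f (t s : R) : R := if (s < t) && (t < 2 * s) then s^-1 else 0.
have f0 t s : 0 < t -> 0 <= f t s.
  by move=> t0; rewrite /f; case: ifP => // /andP[_ ts]; rewrite invr_ge0; lra.
have mf t : measurable_fun setT (EFin \o f t).
  apply/measurable_EFinP; apply: measurable_fun_ifT => //.
    by apply: measurable_and; apply: measurable_fun_ltr => //; exact: mulrl_measurable.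
  exact: measurable_invr.
(* The measure [ds/s] is invariant under dilations, so [s -> t s] reduces every [t] to [t = 1]. *)
have ft t : 0 < t -> (\int[mu]_s (f t s)%:E = \int[mu]_s (f 1 s)%:E)%E.
  move=> t0.
  have E s : (f 1 s)%:E = (t%:E * (f t (t * s))%:E)%E.
    rewrite -EFinM /f [2 * (t * s)]mulrCA gtr_pMr// ltr_pMr//.
    case: ifP; rewrite ?mulr0// => _.
    by rewrite invfM mulrA mulfV ?mul1r// gt_eqF.
  under [RHS]eq_integral do rewrite E.
  rewrite ge0_integralZl//=; last 3 first.
  - by apply: (measurableT_comp (mf t)); exact: mulrl_measurable.
  - by move=> s _; rewrite lee_fin f0.
  - by rewrite lee_fin ltW.
  rewrite (@ge0_integral_scale _ t (EFin \o f t))//; last first.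
    by move=> s; rewrite lee_fin f0.
  by rewrite muleA -EFinM divff ?mul1e// gt_eqF.
(* The constant is [ln 2]; only its finiteness and positivity matter, and both follow from
   [1 <= 1/s <= 2] on [(1/2, 1)]. *)
have I1 : (\int[mu]_s (f 1 s)%:E \is a fin_num)%E.
  rewrite ge0_fin_numE; last by apply: integral_ge0 => s _; rewrite lee_fin f0.
  apply: (@le_lt_trans _ _ (\int[mu]_(s in `[0%R, 1%R]) 2%:E)%E).
    rewrite [leRHS]integral_mkcond; apply: ge0_le_integral => //.
    - by move=> s _; rewrite lee_fin f0.
    - exact: (mf 1).
    - by apply/(measurable_restrictT _ _).1 => //; exact: measurable_cst.
    move=> s _; rewrite patchE mem_setE in_itv/= /f.
    case: ifPn => [/andP[s1 s2]|_]; last by case: ifP => _; rewrite lee_fin.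
    rewrite ifT; last by apply/andP; split; lra.
    by rewrite lee_fin -[leRHS]invrK lef_pV2 ?posrE; lra.
  rewrite integral_cst//= lebesgue_measure_itv/= lte_fin ltr01.
  by rewrite -EFinD -EFinM ltry.
exists (fine (\int[mu]_s (f 1 s)%:E)%E) => [|t t0]; last by rewrite fineK// -(ft t t0).
rewrite -lte_fin fineK//.
apply: (@lt_le_trans _ _ (\int[mu]_(s in `]2^-1%R, 1%R[) 1%:E)%E).
  rewrite integral_cst//= lebesgue_measure_itv/= lte_fin ifT; last lra.
  by rewrite mul1e -EFinB lte_fin; lra.
rewrite [leLHS]integral_mkcond; apply: ge0_le_integral => //.
- by move=> s _; rewrite patchE; case: ifP.
- by apply/(measurable_restrictT _ _).1 => //; exact: measurable_cst.
- exact: (mf 1).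
move=> s _; rewrite patchE mem_setE in_itv/= /f.
case: ifPn => [/andP[s1 s2]|_]; last by rewrite lee_fin f0.
rewrite ifT; last by apply/andP; split; lra.
by rewrite lee_fin invr_ge1 ?unitfE; lra.
Qed.

Variable n : nat.
Local Notation lr := (@lebesgue_rV R n.+1).

(** The weight is cut off at [s <= 0], so this is the half-line integral of [s^n u(s w)], with [n]
    the dimension minus one. *)
Definition ray_integral (u : 'rV[R]_n.+1 -> \bar R) (w : 'rV[R]_n.+1) : \bar R :=
  (\int[mu]_s ((if (0 < s)%R then s ^+ n else 0)%:E * u (s *: w)))%E.

Definition shell (y : 'rV[R]_n.+1) : R :=
  if (1 < enorm y) && (enorm y < 2) then 1 else 0.

Lemma measurable_shell : measurable_fun setT shell.
Proof.
apply: measurable_fun_ifT => //.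
by apply: measurable_and; apply: measurable_fun_ltr => //; exact: measurable_enorm.
Qed.

Lemma shell_ge0 y : 0 <= shell y.
Proof. by rewrite /shell; case: ifP. Qed.

Lemma measurable_pos_pow :
  measurable_fun setT (fun s : R => if (0 < s)%R then s ^+ n else 0).
Proof.
by apply: measurable_fun_ifT => //; exact: measurable_fun_ltr.
Qed.

Lemma pos_pow_ge0 (s : R) : 0 <= (if (0 < s)%R then s ^+ n else 0).
Proof. by case: ifP => // /ltW s0; rewrite exprn_ge0. Qed.

(** Both sides integrate [F (s, y) = s^n shell(y) u(s y)] over [s > 0]. With [y] first, [x = s y]
    leaves [u(x)/s] on [s < |x| < 2 s], whose integral in [s] is [k u(x)] for [x != 0]. With [s]
    first, replacing [s] by [s/|y|] yields the ray integral in the direction [y/|y|] times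
    [|y|^-(n+1)]. The condition [u 0 = 0] covers the origin, where the dyadic integral is [0]
    instead of [k]. *)
Lemma polar_coordinates : exists2 k : R, 0 < k &
  forall u : 'rV[R]_n.+1 -> \bar R, measurable_fun [set: _] u ->
    (forall x, 0 <= u x)%E -> u 0 = 0%E ->
  (k%:E * \int[lr]_x u x =
   \int[lr]_y ((shell y * enorm y ^- n.+1)%:E *
               ray_integral u ((enorm y)^-1 *: y)))%E.
Proof.
have [k k0 kE] := integral_inv_dyadic; exists k => // u mu_ u0 u00.
pose F (p : R * 'rV[R]_n.+1) : \bar R :=
  (((if 0 < p.1 then p.1 ^+ n else 0) * shell p.2)%:E * u (p.1 *: p.2))%E.
have mF : measurable_fun [set: measurableTypeR R * 'rV[R]_n.+1] F.
  apply: emeasurable_funM; last first.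
    by apply: (measurableT_comp mu_); exact: measurable_scale_pair.
  apply/measurable_EFinP; apply: measurable_funM.
    by apply: (measurableT_comp measurable_pos_pow); exact: measurable_fst.
  by apply: (measurableT_comp measurable_shell); exact: measurable_snd.
have F0 p : (0 <= F p)%E.
  by rewrite mule_ge0// lee_fin mulr_ge0 ?shell_ge0 ?pos_pow_ge0.
pose G (p : R * 'rV[R]_n.+1) : \bar R :=
  ((if (p.1 < enorm p.2) && (enorm p.2 < 2 * p.1) then p.1^-1 else 0)%:E
   * u p.2)%E.
have mG : measurable_fun [set: measurableTypeR R * 'rV[R]_n.+1] G.
  apply: emeasurable_funM; last first.
    by apply: (measurableT_comp mu_); exact: measurable_snd.
  have me : measurable_fun [set: measurableTypeR R * 'rV[R]_n.+1]
      (fun p => enorm p.2).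
    by apply: (measurableT_comp (@measurable_enorm R n.+1)); exact: measurable_snd.
  apply/measurable_EFinP; apply: measurable_fun_ifT => //.
    apply: measurable_and; apply: measurable_fun_ltr => //.
    by apply: measurable_funM => //; exact: measurable_fst.
  by apply: (measurableT_comp measurable_invr); exact: measurable_fst.
have G0 p : (0 <= G p)%E.
  rewrite mule_ge0// lee_fin; case: ifP => // /andP[p1 p2].
  by rewrite invr_ge0; have := enorm_ge0 p.2; lra.
have FG s : (\int[lr]_y F (s, y) = \int[lr]_x G (s, x))%E.
  have [s0|s0] := ltP 0 s; last first.
    rewrite !integral0_eq// => x _; rewrite /F /G/=.
      rewrite ifF ?mul0e//; apply/negP => /andP[_ p2].
      by have := enorm_ge0 x; lra.
    by rewrite ltNge s0/= mul0r mul0e.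
  pose v x := ((s ^+ n * shell (s^-1 *: x))%:E * u x)%E.
  have mv : measurable_fun setT v.
    apply: emeasurable_funM => //; apply/measurable_EFinP.
    apply: measurable_funM => //; apply: (measurableT_comp measurable_shell).
    exact: measurable_scale_rV.
  have v0 x : (0 <= v x)%E.
    by rewrite mule_ge0// lee_fin mulr_ge0 ?shell_ge0// exprn_ge0// ltW.
  transitivity (\int[lr]_y v (s *: y))%E.
    apply: eq_integral => y _.
    by rewrite /F /v/= s0 scalerA mulVf ?scale1r// gt_eqF.
  rewrite (@ge0_integral_scale_rV _ _ s v)//.
  rewrite -ge0_integralZl//; last by rewrite lee_fin invr_ge0 exprn_ge0// ltW.
  apply: eq_integral => x _.
  rewrite /v /G/= muleA -EFinM /shell enormZ gtr0_norm ?invr_gt0//.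
  have -> : (1 < s^-1 * enorm x) = (s < enorm x).
    by rewrite [s^-1 * _]mulrC ltr_pdivlMr// mul1r.
  have -> : (s^-1 * enorm x < 2) = (enorm x < 2 * s).
    by rewrite [s^-1 * _]mulrC ltr_pdivrMr.
  congr (_%:E * _)%E; case: ifP => _; last by rewrite !mulr0.
  by rewrite mulr1 exprS invfM -mulrA mulVf ?mulr1// expf_neq0// gt_eqF.
transitivity (\int[lr]_y \int[mu]_s F (s, y))%E; last first.
  apply: eq_integral => y _.
  rewrite /ray_integral /F/=.
  rewrite {2}/shell; have [/andP[y1 y2]|yA] := boolP (_ && _); last first.
    rewrite mul0r mul0e integral0_eq// => s _.
    by rewrite /shell (negbTE yA) mulr0 mul0e.
  have y0 : 0 < enorm y by lra.
  pose v s := ((if (0 < s)%R then s ^+ n else 0)%:E * u (s *: ((enorm y)^-1 *: y)))%E.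
  have mv : measurable_fun [set: R] v.
    apply: emeasurable_funM; first by apply/measurable_EFinP; exact: measurable_pos_pow.
    apply: (measurableT_comp mu_).
    apply: measurable_fun_rVP => i; under eq_fun do rewrite mxE.
    exact: mulrr_measurable.
  have v0 s : (0 <= v s)%E by rewrite mule_ge0// lee_fin pos_pow_ge0.
  have -> : (\int[mu]_s ((if (0 < s)%R then s ^+ n else 0)%:E *
      u (s *: ((enorm y)^-1 *: y))) = (enorm y)%:E * \int[mu]_s v (enorm y * s)%R)%E.
    rewrite (@ge0_integral_scale _ _ v)// muleA -EFinM divff ?mul1e//.
    by rewrite gt_eqF.
  rewrite -!ge0_integralZl//; first last.
  - by rewrite lee_fin ltW.
  - by apply: (measurableT_comp mv); exact: mulrl_measurable.
  - by rewrite lee_fin mul1r invr_ge0 exprn_ge0// ltW.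
  - by move=> s _; rewrite mule_ge0// lee_fin ltW.
  - apply: emeasurable_funM => //.
    by apply: (measurableT_comp mv); exact: mulrl_measurable.
  apply: eq_integral => s _.
  rewrite /v/= scalerA.
  have -> : enorm y * s / enorm y = s by field; rewrite gt_eqF.
  rewrite pmulr_rgt0// /shell y1 y2/= !muleA -!EFinM.
  congr (_%:E * _)%E; case: ifP; rewrite ?mul0r ?mulr0// => _.
  rewrite mulr1 mul1r exprMn mulrA exprSr invfM.
  rewrite [X in _ = X * _ * _](_ : _ = (enorm y ^+ n)^-1); last first.
    by field; rewrite expf_neq0 ?gt_eqF.
  by rewrite mulVf ?mul1r// expf_neq0// gt_eqF.
transitivity (\int[mu]_s \int[lr]_y F (s, y))%E; last exact: fubini_tonelli.
under [RHS]eq_integral do rewrite FG.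
transitivity (\int[lr]_x \int[mu]_s G (s, x))%E; last first.
  by apply/esym; exact: fubini_tonelli.
rewrite -ge0_integralZl//; last by rewrite lee_fin ltW.
apply: eq_integral => x _.
have [->|x0] := eqVneq x 0.
  by rewrite u00 mule0 integral0_eq// => s _; rewrite /G/= u00 mule0.
rewrite /G/= ge0_integralZr//.
- by rewrite kE// enorm_gt0.
- apply/measurable_EFinP; apply: measurable_fun_ifT => //.
    by apply: measurable_and; apply: measurable_fun_ltr => //; exact: mulrl_measurable.
  exact: measurable_invr.
- move=> s _; rewrite lee_fin; case: ifP => // /andP[p1 p2].
  by rewrite invr_ge0; have := enorm_ge0 x; lra.
Qed.

End polar.

Section polar_consequences.
Context {R : realType} {n : nat}.
Local Notation mu := (@lebesgue_measure R).
Local Notation lr := (@lebesgue_rV R n.+1).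

(** Stands in for integration over the sphere: an identity proved on each ray passes to the whole
    space. *)
Lemma eq_integral_rays (u v : 'rV[R]_n.+1 -> \bar R) :
  measurable_fun [set: _] u -> measurable_fun [set: _] v ->
  (forall x, 0 <= u x)%E -> (forall x, 0 <= v x)%E -> u 0 = 0%E -> v 0 = 0%E ->
  (forall w, enorm w = 1 -> ray_integral u w = ray_integral v w) ->
  (\int[lr]_x u x = \int[lr]_x v x)%E.
Proof.
move=> mu_ mv u0 v0 u00 v00 uv.
have [k k0 polar] := @polar_coordinates R n.
have : (k%:E * \int[lr]_x u x = k%:E * \int[lr]_x v x)%E.
  rewrite (polar _ mu_ u0 u00) (polar _ mv v0 v00); apply: eq_integral => y _.
  have [->|y0] := eqVneq y 0; last first.
    by rewrite uv// enormZ ger0_norm ?invr_ge0 ?enorm_ge0// mulVf// enorm_eq0.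
  by rewrite /shell enorm0 ltr10/= mul0r !mul0e.
move=> /(congr1 (fun z => k^-1%:E * z)%E).
by rewrite !muleA -!EFinM mulVf ?gt_eqF// !mul1e.
Qed.

(** The singleton is invariant under dilation by 2, so its measure equals [2^-(n+1)] times itself,
    and it is finite. *)
Lemma lebesgue_rV_set1_0 : lr [set 0] = 0%E.
Proof.
have m0 : measurable [set 0 : 'rV[R]_n.+1].
  by apply: compact_measurable_rV; exact: compact_set1.
have f0 : lr [set 0] \is a fin_num.
  rewrite ge0_fin_numE//; apply: le_lt_trans (lebesgue_rV_eball_lty n.+1 1).
  apply: le_measure; rewrite ?inE//; first exact: measurable_eball.
  by move=> x ->; rewrite /eball/= enorm0.
have := @lebesgue_rV_scale R n.+1 2 _ (ltr0Sn _ 1) m0.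
have -> : (fun x => 2 *: x) @^-1` [set 0 : 'rV[R]_n.+1] = [set 0].
  apply/seteqP; split => x /=; last by move=> ->; rewrite scaler0.
  by move=> /eqP; rewrite scaler_eq0 pnatr_eq0/= => /eqP.
rewrite -(fineK f0) -EFinM => -[] E.
have : (1 - 2 ^- n.+1) * fine (lr [set 0]) = 0.
  by rewrite mulrBl mul1r -E subrr.
move=> /eqP; rewrite mulf_eq0 => /orP[|/eqP -> //].
rewrite subr_eq0 => /eqP/(congr1 (fun z => z * 2 ^+ n.+1)).
rewrite mul1r mulVf ?expf_neq0// => E2.
by have : 1 < 2 ^+ n.+1 :> R; [rewrite exprn_egt1// ltr1n|rewrite E2 ltxx].
Qed.

(** A radial function has the same ray integral in all unit directions, so this factors out of the
    polar formula and leaves the constant [C]. *)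
Lemma radial_integral : exists2 k : R, 0 < k &
  forall H : R -> \bar R, measurable_fun [set: R] H ->
    (forall s, 0 <= H s)%E -> H 0 = 0%E ->
  (\int[lr]_x H (enorm x) =
   k%:E * \int[mu]_s ((if (0 < s)%R then s ^+ n else 0)%:E * H s))%E.
Proof.
have [k k0 polar] := @polar_coordinates R n.
pose C : \bar R := (\int[lr]_y (shell y * enorm y ^- n.+1)%:E)%E.
have mw : measurable_fun setT (fun y : 'rV[R]_n.+1 => shell y * enorm y ^- n.+1).
  apply: measurable_funM; first exact: measurable_shell.
  apply: (measurableT_comp measurable_invr); apply: measurable_funX.
  exact: measurable_enorm.
have w0 (y : 'rV[R]_n.+1) : 0 <= shell y * enorm y ^- n.+1.
  by rewrite mulr_ge0 ?shell_ge0// invr_ge0 exprn_ge0// enorm_ge0.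
have radial_ray (H : R -> \bar R) (w : 'rV[R]_n.+1) : enorm w = 1 ->
    ray_integral (fun x => H (enorm x)) w =
    (\int[mu]_s ((if (0 < s)%R then s ^+ n else 0)%:E * H s))%E.
  move=> w1; apply: eq_integral => s _; rewrite enormZ w1 mulr1.
  by case: ifPn => [s0|_]; rewrite ?mul0e// gtr0_norm.
have CE (H : R -> \bar R) : measurable_fun [set: R] H ->
    (forall s, 0 <= H s)%E -> H 0 = 0%E ->
    (k%:E * \int[lr]_x H (enorm x) =
     C * \int[mu]_s ((if (0 < s)%R then s ^+ n else 0)%:E * H s))%E.
  move=> mH H0 H00.
  rewrite polar//; last 2 first.
  - by apply: (measurableT_comp mH); exact: measurable_enorm.
  - by rewrite enorm0.
  have I0 : (0 <= \int[mu]_s ((if (0 < s)%R then s ^+ n else 0)%:E * H s))%E.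
    by apply: integral_ge0 => s _; rewrite mule_ge0// lee_fin pos_pow_ge0.
  rewrite /C -ge0_integralZr /=; [|exact: measurableT|exact/measurable_EFinP|..|exact: I0]; last first.
    by move=> y _; rewrite lee_fin.
  apply: eq_integral => y _.
  have [->|y0] := eqVneq y 0.
    by rewrite /shell enorm0 ltr10/= mul0r !mul0e.
  by rewrite radial_ray// enormZ ger0_norm ?invr_ge0 ?enorm_ge0// mulVf// enorm_eq0.
have C0 : (0 <= C)%E by apply: integral_ge0 => y _; rewrite lee_fin.
have Cfin : C \is a fin_num.
  rewrite ge0_fin_numE//; apply: le_lt_trans (lebesgue_rV_eball_lty n.+1 2).
  rewrite -[leRHS]mul1e -integral_cst//; last exact: measurable_eball.
  rewrite [leRHS]integral_mkcond; apply: ge0_le_integral => //.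
  - by move=> y _; rewrite lee_fin.
  - exact/measurable_EFinP.
  - by apply/(measurable_restrictT _ _).1 => //; exact: measurable_eball.
  move=> y _; rewrite patchE /shell /eball; case: ifPn => [/andP[y1 y2]|_].
    have y0 : 0 < enorm y by lra.
    by rewrite mul1r mem_set//= lee_fin invf_le1 ?exprn_gt0// exprn_ege1// ltW.
  by rewrite mul0r; case: ifP.
(* If [C] were zero, the indicator of the punctured ball of radius [n+2] would integrate to zero,
   although that ball contains the punctured unit cube. *)
have C1 : (0 < C)%E.
  rewrite lt_neqAle C0 andbT; apply/eqP => C00.
  pose H (s : R) : \bar R := (if (0 < s) && (s < n.+2%:R) then 1 else 0)%:E.
  have mH : measurable_fun setT H.
    apply/measurable_EFinP; apply: measurable_fun_ifT => //.
    by apply: measurable_and; exact: measurable_fun_ltr.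
  have H0 s : (0 <= H s)%E by rewrite lee_fin; case: ifP.
  have I0 : (\int[lr]_x H (enorm x) = 0)%E.
    have := CE H mH H0; rewrite {1}/H ltxx => /(_ erefl); rewrite -C00 mul0e.
    by move=> /eqP; rewrite mule_eq0 eqe gt_eqF//= => /eqP.
  have m0 : measurable [set 0 : 'rV[R]_n.+1].
    by apply: compact_measurable_rV; exact: compact_set1.
  pose D := ~` [set 0 : 'rV[R]_n.+1].
  have : (lr (cube (n := n.+1)) <= 0)%E.
    suff E : lr (cube (n := n.+1)) =
        (\int[lr]_(x in D) (\1_(cube (n := n.+1)) x)%:E)%E; last first.
      rewrite integral_indic//; [|exact: measurableC|exact: measurable_cube].
      have f2 : (lr (cube (n := n.+1)) < +oo)%E by rewrite lebesgue_rV_cube ltry.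
      have I2 : lr (cube (n := n.+1) `&` [set 0]) = 0%E.
        apply/eqP; rewrite eq_le measure_ge0 andbT -lebesgue_rV_set1_0.
        by apply: le_measure; rewrite ?inE//; apply: measurableI => //; exact: measurable_cube.
      rewrite /D -setDE; apply/esym.
      apply: etrans (@measureD _ _ _ lr _ _ (@measurable_cube R n.+1) m0 f2) _.
      by apply: etrans (sube0 _); congr (_ - _)%E; exact: I2.
    rewrite E -I0 [leLHS]integral_mkcond; apply: ge0_le_integral => //.
    - by move=> x _; rewrite patchE; case: ifP => // _; rewrite lee_fin.
    - apply/(measurable_restrictT _ _).1; first exact: measurableC.
      by apply/measurable_EFinP; apply: measurable_indic; exact: measurable_cube.
    - by apply: (measurableT_comp mH); exact: measurable_enorm.
    move=> x _; rewrite patchE; case: ifPn => [|_]; last by rewrite lee_fin; case: ifP.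
    rewrite inE/= => /eqP x0; rewrite lee_fin indicE enorm_gt0 x0/=.
    case: (boolP (x \in _)) => [|_]; last by case: ifP.
    by rewrite inE => /cube_enorm ->.
  by rewrite lebesgue_rV_cube lee_fin leNgt exprn_gt0.
exists (fine C / k); first by rewrite divr_gt0// -lte_fin fineK.
move=> H mH H0 H00.
by rewrite mulrC EFinM fineK// -muleA -CE// muleA -EFinM mulVf ?mul1e// gt_eqF.
Qed.

End polar_consequences.

(** * Primitives of square integrable functions *)

Section primitives.
Context {R : realType}.
Variable r : R.
Hypothesis r0 : 0 < r.
Local Notation mu := (@lebesgue_measure R).

(* Profiles are represented by their derivative [h], set to [0] outside [(0, r)],
   so that [prim h] is the primitive vanishing from [r] on. *)
Definition L2fun (h : R -> R) : Prop :=
  [/\ measurable_fun [set: R] h, forall t, ~~ (0 < t < r) -> h t = 0 &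
      (\int[mu]_t (h t ^+ 2)%:E < +oo)%E].

Definition prim (h : R -> R) (t : R) : R := - \int[mu]_(s in `]t, +oo[) h s.

Lemma continuous_bounded_itv (g : R -> R) (a b : R) : continuous g ->
  exists M, forall t, a <= t <= b -> `|g t| <= M.
Proof.
move=> cg; have [ab|ba] := leP a b; last first.
  by exists 0 => t /andP[at_ tb]; have := le_trans at_ tb; rewrite leNgt ba.
have [|c _ cM] := @EVT_max R (fun t => `|g t|) a b ab.
  apply: continuous_subspaceT => x; apply: continuous_comp; first exact: cg.
  exact: norm_continuous.
by exists `|g c| => t tab; apply: cM; rewrite in_itv/=.
Qed.

(** On [(0, r)] one has [|h| <= 1 + h^2], and [h] vanishes elsewhere. *)
Lemma L2fun_integrable h : L2fun h -> mu.-integrable setT (EFin \o h).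
Proof.
move=> [mh h0 h2].
pose A : set R := `]0, r[%classic.
have I : mu.-integrable setT (EFin \o (fun t => \1_A t + h t ^+ 2)).
  have -> : EFin \o (fun t => \1_A t + h t ^+ 2) =
      ((EFin \o \1_A) \+ (fun t => (h t ^+ 2)%:E))%E by [].
  apply: integrableD => //.
    exact: integrable_indic_itv.
  apply/integrableP; split.
    by apply/measurable_EFinP; apply: measurable_funX.
  by under eq_integral do rewrite gee0_abs ?lee_fin ?sqr_ge0//.
apply: le_integrable I => //; first exact/measurable_EFinP.
move=> t _; rewrite /= lee_fin indicE mem_setE in_itv/=.
have [_|tr] := boolP (0 < t < r); last by rewrite h0// normr0.
rewrite [leRHS]ger0_norm ?addr_ge0 ?sqr_ge0//= -[h t ^+ 2]real_normK ?num_real//.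
by have := sqr_ge0 (`|h t| - 1); nra.
Qed.

Lemma L2funB h k : L2fun h -> L2fun k -> L2fun (fun t => h t - k t).
Proof.
move=> [mh h0 h2] [mk k0 k2]; split; first exact: measurable_funB.
  by move=> t tr; rewrite h0// k0// subr0.
apply: (@le_lt_trans _ _ (\int[mu]_t (2%:E * (h t ^+ 2)%:E + 2%:E * (k t ^+ 2)%:E))%E).
  apply: ge0_le_integral => //.
  - by move=> t _; rewrite lee_fin sqr_ge0.
  - by apply/measurable_EFinP; apply: measurable_funX; exact: measurable_funB.
  - apply/measurable_EFinP; apply: measurable_funD; apply: measurable_funM => //;
      exact: measurable_funX.
  - move=> t _; rewrite -!EFinM -EFinD lee_fin.
    by have := sqr_ge0 (h t + k t); nra.
rewrite ge0_integralD//; last 4 first.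
- by move=> t _; rewrite mule_ge0// lee_fin sqr_ge0.
- by apply/measurable_EFinP; apply: measurable_funM => //; exact: measurable_funX.
- by move=> t _; rewrite mule_ge0// lee_fin sqr_ge0.
- by apply/measurable_EFinP; apply: measurable_funM => //; exact: measurable_funX.
rewrite !ge0_integralZl//; last 4 first.
- by apply/measurable_EFinP; exact: measurable_funX.
- by move=> t _; rewrite lee_fin sqr_ge0.
- by apply/measurable_EFinP; exact: measurable_funX.
- by move=> t _; rewrite lee_fin sqr_ge0.
by rewrite lte_add_pinfty// lte_mul_pinfty.
Qed.

Lemma L2fun0 : L2fun (cst 0).
Proof.
split => //; rewrite integral0_eq// => x _.
by rewrite /= expr0n.
Qed.

Lemma L2funN h : L2fun h -> L2fun (fun t => - h t).
Proof.
move=> Lh; have := L2funB L2fun0 Lh.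
rewrite (_ : (fun t => - h t) = (fun t => cst 0 t - h t))//.
by apply/funext => t; rewrite /= sub0r.
Qed.

Lemma primB h k t : L2fun h -> L2fun k ->
  prim (fun s => h s - k s) t = prim h t - prim k t.
Proof.
move=> /L2fun_integrable ih /L2fun_integrable ik.
rewrite /prim RintegralB//; [by rewrite opprB opprK addrC|..].
- exact: integrableS ih.
- exact: integrableS ik.
Qed.

Lemma prim0 t : prim (cst 0) t = 0.
Proof. by rewrite /prim /Rintegral/= integral0 oppr0. Qed.

Lemma primN h t : L2fun h -> prim (fun s => - h s) t = - prim h t.
Proof.
move=> Lh; have := primB t L2fun0 Lh; rewrite prim0 sub0r => <-.
by congr (prim _ t); apply/funext => s /=; rewrite sub0r.
Qed.

Lemma prim_sub h s t : L2fun h -> s <= t ->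
  prim h t - prim h s = \int[mu]_(x in `]s, t]) h x.
Proof.
move=> /L2fun_integrable ih st.
rewrite /prim opprK addrC; apply/eqP; rewrite subr_eq addrC -subr_eq; apply/eqP.
apply: Rintegral_itvB; rewrite ?bnd_simp//.
exact: integrableS ih.
Qed.

Lemma prim_ge_r h t : L2fun h -> r <= t -> prim h t = 0.
Proof.
move=> [_ h0 _] rt; rewrite /prim /Rintegral integral0_eq ?oppr0// => s.
by rewrite /= in_itv/= andbT => ts; rewrite h0//; apply/negP => /andP[_ sr]; lra.
Qed.

Lemma prim_bounded h : L2fun h -> exists M, forall t, `|prim h t| <= M.
Proof.
move=> Lh; have ih := L2fun_integrable Lh; exists (\int[mu]_s `|h s|) => t.
have ih' : mu.-integrable `]t, +oo[ (EFin \o h) by exact: integrableS ih.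
rewrite /prim normrN; apply: le_trans (le_normr_Rintegral _ ih') _ => //.
rewrite Rintegral_mkcond; apply: le_Rintegral => //.
- rewrite -restrict_EFin; apply/(integrable_mkcond _ _).1 => //.
  exact: integrable_norm ih'.
- exact: integrable_norm.
- by move=> s _; rewrite patchE; case: ifP => _; rewrite ?normr_ge0 ?lexx.
Qed.

Lemma prim_continuous h : L2fun h -> continuous (prim h).
Proof.
move=> Lh t; have ih := L2fun_integrable Lh.
have mh : measurable_fun [set: R] h by case: Lh.
pose F (x : R) := \int[mu]_(s in `[t - 1, x]) h s.
have cF : {for t, continuous F}.
  apply: (@within_continuous_continuous _ _ _ (t - 1) (t + 1)); last 1 first.
  - by rewrite in_itv/=; lra.
  - by lra.
  apply: parameterized_integral_continuous; first by lra.
  exact: integrableS ih.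
have E x : t - 1 <= x -> prim h x = prim h (t - 1) + F x.
  move=> tx; rewrite /F -Rintegral_itv_obnd_cbnd; last exact: integrableS ih.
  by rewrite -prim_sub// addrC subrK.
rewrite /continuous_at E; last lra.
have : (prim h (t - 1) + F x) @[x --> t] --> prim h (t - 1) + F t.
  by apply: cvgD; [exact: cvg_cst|exact: cF].
apply: cvg_trans; apply: near_eq_cvg.
have : \forall x \near t, t - 1 < x by apply: lt_nbhsr; lra.
by apply: filterS => x /ltW tx; apply/esym; exact: E.
Qed.

Lemma integrable_mul_bounded h (g : R -> R) (M : R) : L2fun h ->
  measurable_fun [set: R] g -> (forall t, 0 < t < r -> `|g t| <= M) ->
  mu.-integrable setT (fun t => (h t * g t)%:E).
Proof.
move=> Lh mg gM; have ih := L2fun_integrable Lh; have [mh h0 _] := Lh.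
have I : mu.-integrable setT (fun t => M%:E * (h t)%:E)%E.
  by apply: integrableZl => //; exact: ih.
apply: (le_integrable _ _ _ I) => //.
  by apply/measurable_EFinP; exact: measurable_funM.
move=> t _; rewrite -EFinM /= lee_fin normrM normrM mulrC.
have [tr|tr] := boolP (0 < t < r); last by rewrite h0// normr0 !mulr0.
by rewrite ler_wpM2r// (le_trans (gM t tr))// ler_norm.
Qed.

End primitives.

(** * Integration by parts for primitives *)

Section by_parts.
Context {R : realType}.
Variable r : R.
Hypothesis r0 : 0 < r.
Local Notation mu := (@lebesgue_measure R).

(** The inner integral in [t], at fixed [s], of the Fubini argument for [prim_by_parts]. *)
Lemma prim_mulr h (s c : R) : L2fun r h ->
  (\int[mu]_t (if s < t then h t * c else 0)%:E = (- (prim h s * c))%:E)%E.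
Proof.
move=> Lh; have ih := L2fun_integrable Lh.
have I : mu.-integrable `]s, +oo[ (EFin \o h) by exact: integrableS ih.
have -> : - (prim h s * c) = \int[mu]_(t in `]s, +oo[) (h t * c).
  by rewrite /prim mulNr opprK; apply/esym; apply: RintegralZr.
have I' : mu.-integrable `]s, +oo[ (EFin \o (fun t => h t * c)).
  exact: (integrableZr _ _ I).
rewrite /Rintegral fineK; last exact: integrable_fin_num I'.
rewrite [RHS]integral_mkcond; apply: eq_integral => t _.
by rewrite patchE mem_setE in_itv/= andbT; case: ifP.
Qed.

(** The inner integral in [s], at fixed [t], of the same Fubini argument. *)
Lemma integral_mul_derive1 (z : R -> R) (c t : R) : 0 < t ->
  (forall s, derivable z s 1) -> continuous (derive1 z) ->
  (\int[mu]_s (if (0 < s) && (s < t) then c * derive1 z s else 0)%:E =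
   (c * z t - c * z 0)%:E)%E.
Proof.
move=> t0 dz cz.
have mdz : measurable_fun [set: R] (derive1 z) by exact: continuous_measurable_fun.
have cz0 : continuous z.
  by move=> s; apply: differentiable_continuous; apply/derivable1_diffP.
have -> : (c * z t - c * z 0)%:E = (c%:E * ((z t)%:E - (z 0)%:E))%E.
  by rewrite -mulrBr EFinM EFinB.
have FTC : (\int[mu]_(x in `[0%R, t]) (derive1 z x)%:E = (z t)%:E - (z 0)%:E)%E.
  apply: continuous_FTC2; first exact: t0.
  - exact: continuous_subspaceT.
  - split => [x _||]; first exact: dz.
      exact/cvg_at_right_filter/cz0.
    exact/cvg_at_left_filter/cz0.
  - by move=> x _.
have I : mu.-integrable `]0, t[ (EFin \o derive1 z).
  have Ic : mu.-integrable `[0, t] (EFin \o derive1 z).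
    apply: continuous_compact_integrable; first exact: segment_compact.
    exact: continuous_subspaceT.
  by apply: integrableS Ic => //; exact: subset_itv_oo_cc.
rewrite -FTC (@integral_itv_bndoo _ _ _ _ true false); last first.
  by apply/measurable_EFinP; exact: measurable_funTS.
rewrite -integralZl//.
rewrite [RHS]integral_mkcond; apply: eq_integral => s _.
by rewrite patchE mem_setE in_itv/=; case: ifP => // _; rewrite EFinM.
Qed.

(** The kernel lives on [0 < s < t < r] and is at most [M |h t|] there, so its double integral is at
    most [M r] times the integral of [|h|]. *)
Lemma integrable_prim_kernel (h g : R -> R) (M : R) : L2fun r h ->
  measurable_fun [set: R] g -> (forall s, 0 <= s <= r -> `|g s| <= M) ->
  (mu \x mu)%E.-integrable setT (fun p : R * R =>
    (if (0 < p.1) && (p.1 < p.2) then h p.2 * g p.1 else 0)%:E).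
Proof.
move=> Lh mg gM; have ih := L2fun_integrable Lh; have [mh h0 _] := Lh.
set F := (F in integrable _ _ F).
have mF : measurable_fun [set: measurableTypeR R * measurableTypeR R] F.
  apply/measurable_EFinP; apply: measurable_fun_ifT => //.
    by apply: measurable_and; apply: measurable_fun_ltr.
  apply: measurable_funM.
    by apply: (measurableT_comp mh); exact: measurable_snd.
  by apply: (measurableT_comp mg); exact: measurable_fst.
apply/integrable21ltyP => //.
apply: (@le_lt_trans _ _ (\int[mu]_t (`|M * r| * `|h t|)%:E)%E); last first.
  have /integrableP[_] : mu.-integrable setT (fun t => ((M * r)%:E * (h t)%:E)%E).
    by apply: integrableZl => //; exact: ih.
  by under eq_integral do rewrite -EFinM abse_EFin normrM.
apply: ge0_le_integral => //.
- by move=> t _; apply: integral_ge0.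
- by apply: (@measurable_fun_fubini_tonelli_G _ _ _ _ _ mu (abse \o F)) => //=;
    apply: measurableT_comp.
- apply/measurable_EFinP; apply: measurable_funM => //; exact: measurableT_comp.
move=> t _.
apply: (@le_trans _ _ (\int[mu]_(s in `]0%R, r[) (M * `|h t|)%:E)%E).
  rewrite [leRHS]integral_mkcond; apply: ge0_le_integral => //.
  - apply: measurableT_comp => //; exact: (measurableT_comp mF (measurable_pair2 _)).
  - by apply/(measurable_restrictT _ _).1 => //; exact: measurable_cst.
  move=> s _; rewrite patchE mem_setE in_itv/= /F/=.
  case: ifPn => [/andP[s0 st]|_]; last first.
    rewrite normr0; case: ifP => // _; rewrite lee_fin mulr_ge0//.
    by apply: le_trans (gM 0 _) => //; rewrite lexx ltW.
  have [/andP[_ tr]|tr] := boolP (0 < t < r); last first.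
    by rewrite h0// mul0r normr0 mulr0; case: ifP.
  rewrite s0 (lt_trans st tr)/= lee_fin normrM mulrC ler_wpM2r// gM//.
  by rewrite !ltW// (lt_trans st).
rewrite integral_cst//= lebesgue_measure_itv/= lte_fin r0 -EFinB -EFinM lee_fin.
by rewrite subr0 mulrAC ler_wpM2r// ler_norm.
Qed.

(** Since [h] is merely integrable, the product is not differentiated pointwise. Instead
    [- prim h s] is written as the integral of [h] over [(s, r)] and the order of integration is
    exchanged, which leaves [h t * (z t - z 0)]. There is no boundary term at [r], where [prim h]
    vanishes. *)
Lemma prim_by_parts h (z : R -> R) : L2fun r h ->
  (forall t, derivable z t 1) -> continuous (derive1 z) ->
  \int[mu]_(s in `]0, r[) (prim h s * derive1 z s) =
  - (prim h 0 * z 0) - \int[mu]_(s in `]0, r[) (h s * z s).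
Proof.
move=> Lh dz cz; have [mh h0 _] := Lh.
have [M zM] := continuous_bounded_itv 0 r cz.
have mdz : measurable_fun [set: R] (derive1 z) by exact: continuous_measurable_fun.
have cz0 : continuous z.
  by move=> t; apply: differentiable_continuous; apply/derivable1_diffP.
have mz : measurable_fun [set: R] z by exact: continuous_measurable_fun.
have [M' zM'] := continuous_bounded_itv 0 r cz0.
have ihz : mu.-integrable setT (EFin \o (fun t => h t * z t)).
  by apply: (@integrable_mul_bounded _ _ h z M' Lh mz _) => // t /andP[t0 tr];
     apply: zM'; rewrite !ltW.
have ihc : mu.-integrable setT (EFin \o (fun t => h t * z 0)).
  exact: (@integrable_mul_bounded _ _ h (cst (z 0)) `|z 0| Lh).
have EL : (\int[mu]_s \int[mu]_t (if (0 < s) && (s < t) then h t * derive1 z s else 0)%:E =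
    \int[mu]_(s in `]0%R, r[) (- (prim h s * derive1 z s))%:E)%E.
  rewrite [RHS]integral_mkcond; apply: eq_integral => s _.
  rewrite patchE mem_setE in_itv/=; have [s0|s0] := ltP 0 s; last first.
    by transitivity (0%E : \bar R); [exact: integral0_eq|].
  rewrite prim_mulr//=; case: ifPn => // sr.
  by rewrite (@prim_ge_r _ r)// ?mul0r ?oppr0// leNgt.
have ER : (\int[mu]_t \int[mu]_s (if (0 < s) && (s < t) then h t * derive1 z s else 0)%:E =
    \int[mu]_(t in `]0%R, r[) (h t * z t - h t * z 0)%:E)%E.
  rewrite [RHS]integral_mkcond; apply: eq_integral => t _.
  rewrite patchE mem_setE in_itv/=; case: ifPn => [/andP[t0 tr]|tr].
    exact: integral_mul_derive1.
  transitivity (0%E : \bar R); last by [].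
  by apply: integral0_eq => s _; rewrite h0// mul0r if_same.
have ihz' : mu.-integrable `]0, r[ (EFin \o (fun t => h t * z t)).
  exact: integrableS ihz.
have ihc' : mu.-integrable `]0, r[ (EFin \o (fun t => h t * z 0)).
  exact: integrableS ihc.
have ipz : mu.-integrable `]0, r[ (EFin \o (fun s => prim h s * derive1 z s)).
  have Ic : mu.-integrable `[0, r] (EFin \o (fun s => prim h s * derive1 z s)).
    apply: continuous_compact_integrable; first exact: segment_compact.
    apply: continuous_subspaceT => s.
    by apply: cvgM; [exact: prim_continuous Lh s|exact: cz].
  by apply: integrableS Ic => //; exact: subset_itv_oo_cc.
have ih : mu.-integrable `]0, r[ (EFin \o h).
  exact: integrableS (L2fun_integrable Lh).
have FF := Fubini (integrable_prim_kernel Lh mdz zM).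
have {EL FF}ER := etrans (esym EL) (etrans FF ER).
have {}ER : \int[mu]_(s in `]0, r[) (-1 * (prim h s * derive1 z s)) =
    \int[mu]_(s in `]0, r[) (h s * z s - h s * z 0).
  apply: etrans (congr1 fine ER); congr fine.
  by apply: eq_integral => s _; rewrite mulN1r.
have h0E : \int[mu]_(s in `]0, r[) h s = - prim h 0.
  rewrite Rintegral_itv_bndo_bndc//.
  by rewrite -(prim_sub Lh (ltW r0)) (prim_ge_r Lh (lexx r)) sub0r.
move: ER; rewrite RintegralZl// RintegralB// RintegralZr//.
by rewrite h0E mulN1r => /(congr1 -%R); rewrite opprK => ->; rewrite mulNr; ring.
Qed.

End by_parts.

(** * The du Bois-Reymond lemma *)

Section du_bois_reymond.
Context {R : realType}.
Local Notation mu := (@lebesgue_measure R).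

Lemma continuous_integrable_itv (F : R -> R) (a b : R) : continuous F ->
  mu.-integrable `]a, b[ (EFin \o F).
Proof.
move=> cF.
have Ic : mu.-integrable `[a, b] (EFin \o F).
  apply: continuous_compact_integrable; first exact: segment_compact.
  exact: continuous_subspaceT.
by apply: integrableS Ic => //; exact: subset_itv_oo_cc.
Qed.

Lemma continuous_integral_gt0 (F : R -> R) (a b t : R) : continuous F ->
  (forall s, 0 <= F s) -> a < t < b -> 0 < F t ->
  0 < \int[mu]_(s in `]a, b[) F s.
Proof.
move=> cF F0 /andP[at_ tb] Ft.
have : \forall s \near t, F t / 2 < F s.
  have Fh : F t / 2 < F t by lra.
  by have := cF t; move=> /cvgr_gt; exact.
move=> /nbhs_ballP[e /= e0 eF].
pose d := Num.min e (Num.min (t - a) (b - t)).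
have d0 : 0 < d by rewrite !lt_min e0/=; lra.
have [de [da db]] : d <= e /\ d <= t - a /\ d <= b - t.
  by rewrite /d !ge_min !lexx/= !orbT.
apply: (@lt_le_trans _ _ (\int[mu]_(s in `]t - d, t + d[) (F t / 2))).
  rewrite Rintegral_cst//= lebesgue_measure_itv/= lte_fin ifT; last lra.
  by rewrite /= mulr_gt0//; lra.
have I := @continuous_integrable_itv F a b cF.
have sub : `]t - d, t + d[ `<=` `]a, b[.
  by move=> s /=; rewrite !in_itv/= => /andP[? ?]; apply/andP; split; lra.
have I2 := @continuous_integrable_itv F (t - d) (t + d) cF.
apply: (@le_trans _ _ (\int[mu]_(s in `]t - d, t + d[) F s)).
  apply: le_Rintegral => //.
    by apply: continuous_integrable_itv => s; exact: cvg_cst.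
  move=> s /=; rewrite in_itv/= => sd; apply/ltW/eF.
  by rewrite /ball/= ltr_distlC; lra.
rewrite -lee_fin /Rintegral !fineK; [|exact: integrable_fin_num|exact: integrable_fin_num].
apply: ge0_subset_integral => //.
  by case/integrableP : I.
by move=> s _; rewrite lee_fin.
Qed.

(** The test function is the primitive of [g = (u - m) w], with [w] a continuous weight on [(a, b)]
    and [m] the [w]-mean of [u]. Testing with it shows that the integral of [(u - m)^2 w] is
    zero. *)
Lemma du_bois_reymond (u : R -> R) (r : R) : continuous u ->
  (forall z, C1c `]0, r[ z -> \int[mu]_(s in `]0, r[) (u s * derive1 z s) = 0) ->
  forall a b, 0 < a -> a < b -> b < r ->
  exists m, forall t, a < t < b -> u t = m.
Proof.
move=> cu uz a b a0 ab br.
(* Twice the positive part of [(t - a) (b - t)]: continuous, and positive exactly on [(a, b)]. *)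
pose w (t : R) := (t - a) * (b - t) + `|(t - a) * (b - t)|.
have cw : continuous w.
  move=> t.
  have cp : continuous (fun t : R => (t - a) * (b - t)).
    move=> s; apply: cvgM.
      by apply: cvgB; [exact: cvg_id|exact: cvg_cst].
    by apply: cvgB; [exact: cvg_cst|exact: cvg_id].
  by apply: cvgD; [exact: cp|apply: cvg_norm; exact: cp].
have w0 t : 0 <= w t.
  by rewrite /w; set p := (_ * _); have := ler_norm (- p); rewrite normrN; lra.
have wpos t : a < t < b -> 0 < w t.
  by move=> /andP[at_ tb]; have p0 : 0 < (t - a) * (b - t) by [apply: mulr_gt0; lra]; rewrite /w gtr0_norm// addr_gt0.
have wout t : ~~ (a < t < b) -> w t = 0.
  move=> tab; have : (t - a) * (b - t) <= 0.
    move: tab; rewrite negb_and -!leNgt => /orP[|] ?.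
      by apply: mulr_le0_ge0; lra.
    by apply: mulr_ge0_le0; lra.
  by rewrite /w => ?; rewrite ler0_norm// subrr.
pose W := \int[mu]_(s in `]0, r[) w s.
have W0 : 0 < W.
  apply: (@continuous_integral_gt0 _ _ _ ((a + b) / 2)) => //; first lra.
  by apply: wpos; lra.
(* This choice gives [g] integral zero, so that its primitive vanishes again to the right of [b]. *)
pose m := (\int[mu]_(s in `]0, r[) (u s * w s)) / W.
pose g t := (u t - m) * w t.
have cum : continuous (fun t => u t - m).
  by move=> t; apply: cvgB; [exact: cu|exact: cvg_cst].
have cg : continuous g by move=> t; apply: cvgM; [exact: cum|exact: cw].
have cuw : continuous (fun t => u t * w t).
  by move=> t; apply: cvgM; [exact: cu|exact: cw].
have gout t : ~~ (a < t < b) -> g t = 0 by move=> /wout wt; rewrite /g wt mulr0.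
have g_int : \int[mu]_(s in `]0, r[) g s = 0.
  rewrite /g; under eq_Rintegral do rewrite mulrBl.
  rewrite RintegralB//; first last.
  - apply: continuous_integrable_itv => t.
    by apply: cvgM; [exact: cvg_cst|exact: cw].
  - exact: continuous_integrable_itv.
  rewrite RintegralZl//; last exact: continuous_integrable_itv.
  by rewrite /m -/W divfK ?subrr// gt_eqF.
have ig : mu.-integrable setT (EFin \o g).
  have -> : EFin \o g = (EFin \o g) \_ `]0, r[.
    apply/funext => t; rewrite patchE mem_setE in_itv/=; case: ifPn => // tr.
    rewrite gout//; apply: contra tr => /andP[? ?]; lra.
  apply/(integrable_mkcond _ _).1 => //.
  exact: continuous_integrable_itv.
pose z t := \int[mu]_(s in `]-oo, t]) g s.
have zg t : derivable z t 1 /\ derive1 z t = g t.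
  have tt1 : t < t + 1 by lra.
  apply: (@continuous_FTC1 _ g -oo%O t (t + 1) tt1); last exact: cg.
    exact: integrableS ig.
  by rewrite ltNyr.
have z'g : derive1 z = g by apply/funext => t; have [] := zg t.
have cz : C1c `]0, r[ z.
  split; [by move=> t; have [] := zg t|by rewrite z'g|].
  exists `[a, b]%classic; split; first exact: segment_compact.
    by move=> s /=; rewrite !in_itv/= => /andP[? ?]; apply/andP; split; lra.
  move=> t /= /negP; rewrite in_itv/= negb_and -!ltNge => /orP[ta|bt].
    rewrite /z /Rintegral integral0_eq// => s /=; rewrite in_itv/= => st.
    by rewrite gout// negb_and -!leNgt (le_trans st (ltW ta)).
  rewrite -[RHS]g_int /z Rintegral_mkcond [RHS]Rintegral_mkcond.
  apply: eq_Rintegral => s _; rewrite !patchE !mem_setE !in_itv/=.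
  have [/andP[as_ sb]|sab] := boolP (a < s < b).
    by rewrite !ifT//; lra.
  by rewrite gout//; case: ifP; case: ifP.
(* As [g] has integral zero, subtracting the constant [m] from [u] does not change the pairing. *)
have Z : \int[mu]_(s in `]0, r[) ((u s - m) * g s) = 0.
  under eq_Rintegral do rewrite mulrBl.
  rewrite RintegralB//; first last.
  - apply: continuous_integrable_itv => t.
    by apply: cvgM; [exact: cvg_cst|exact: cg].
  - apply: continuous_integrable_itv => t.
    by apply: cvgM; [exact: cu|exact: cg].
  rewrite RintegralZl//; last exact: continuous_integrable_itv.
  by rewrite g_int mulr0 subr0 -z'g uz.
exists m => t tab; apply/eqP; rewrite -subr_eq0; apply/negPn/negP => ut.
have : 0 < \int[mu]_(s in `]0, r[) ((u s - m) * g s).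
  apply: (@continuous_integral_gt0 _ _ _ t).
  - by move=> s; apply: cvgM; [exact: cum|exact: cg].
  - by move=> s; rewrite /g mulrA -expr2 mulr_ge0// sqr_ge0.
  - by move: tab => /andP[? ?]; apply/andP; split; lra.
  - by rewrite /g mulrA -expr2 mulr_gt0 ?wpos// exprn_even_gt0.
by rewrite Z ltxx.
Qed.

End du_bois_reymond.

(** * One-dimensional Sobolev profiles *)

Section W12_primitives.
Context {R : realType}.
Local Notation mu := (@lebesgue_measure R).

(** The retraction of the line onto [[0, r]]; composing with it extends a function continuous on the
    segment to a continuous function on the line. *)
Definition clamp (r t : R) : R := Num.max 0 (Num.min t r).

Lemma clamp_itv (r t : R) : 0 < r -> 0 <= clamp r t <= r.
Proof.
by move=> r0; rewrite /clamp le_max lexx/= ge_max (ltW r0)/= ge_min lexx orbT.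
Qed.

Lemma clamp_id (r t : R) : 0 <= t <= r -> clamp r t = t.
Proof.
by move=> /andP[t0 tr]; rewrite /clamp (min_idPl tr) (max_idPr t0).
Qed.

Lemma dist_clamp (r s t : R) : 0 < r -> `|clamp r s - clamp r t| <= `|s - t|.
Proof.
move=> r0; have := ler_norm (s - t); have := ler_norm (t - s).
rewrite distrC ler_norml /clamp => ? ?.
by case: (leP s r) => ?; case: (leP t r) => ?; case: (leP 0 s) => ?;
  case: (leP 0 t) => ?; rewrite ?(max_idPr (ltW r0)); lra.
Qed.

Lemma continuous_clamp (r : R) (f : R -> R) : 0 < r ->
  {within `[0, r], continuous f} -> continuous (f \o clamp r).
Proof.
move=> r0 + t => cf.
have tI : `[0, r]%classic (clamp r t) by rewrite /= in_itv/= clamp_itv.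
move/subspace_continuousP : cf => /(_ _ tI) cft.
apply: (cvg_comp _ _ _ cft) => P.
rewrite /within/= => /nbhs_ballP[e /= e0 eP].
apply/nbhs_ballP; exists e => // s ts /=; apply: eP; last by rewrite in_itv/= clamp_itv.
by rewrite /ball/=; apply: le_lt_trans ts; exact: dist_clamp.
Qed.

Lemma continuous_cst_closure (u : R -> R) (a b c : R) : continuous u -> a < b ->
  (forall t, a < t < b -> u t = c) -> forall t, a <= t <= b -> u t = c.
Proof.
move=> cu ab uc t /andP[at_ tb]; apply/eqP; rewrite -subr_eq0 -normr_eq0.
apply/negPn/negP => n0; have e0 : 0 < `|u t - c| by rewrite lt_def n0/=.
have /cvgrPdist_lt/(_ _ e0)/nbhs_ballP[d /= d0 dP] := cu t.
have [s [as_ sb st]] : exists s, [/\ a < s, s < b & ball t d s].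
  have [tm|tm] := leP t ((a + b) / 2).
    exists (t + Num.min (d / 2) ((b - a) / 4)).
    rewrite /ball/= opprD addrA subrr sub0r normrN gtr0_norm; last first.
      by rewrite lt_min; lra.
    by split; case: (leP (d / 2) ((b - a) / 4)) => ?; lra.
  exists (t - Num.min (d / 2) ((b - a) / 4)).
  rewrite /ball/= opprB addrCA subrr addr0 gtr0_norm; last first.
    by rewrite lt_min; lra.
  by split; case: (leP (d / 2) ((b - a) / 4)) => ?; lra.
by have := dP s st; rewrite /= (uc s) ?ltxx// as_ sb.
Qed.

(** Take for [h] the weak derivative extended by zero. Then [f - prim h] has zero weak derivative,
    so it is constant by [du_bois_reymond], and it vanishes at [r]. *)
Lemma W12_prim (r : R) (f : R -> R) : 0 < r -> W12 0 r f ->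
  {within `[0, r], continuous f} -> f r = 0 ->
  exists2 h, L2fun r h & forall t, 0 <= t <= r -> f t = prim h t.
Proof.
move=> r0 [_ [k [mk k2] wk]] cf fr.
pose h := k \_ `]0, r[.
have hk t : 0 < t < r -> h t = k t.
  by move=> tr; rewrite /h patchE mem_setE in_itv/= tr.
have Lh : L2fun r h.
  split.
  - by apply/(measurable_restrictT _ _).1.
  - by move=> t tr; rewrite /h patchE mem_setE in_itv/= (negbTE tr).
  - rewrite integral_mkcond in k2; apply: le_lt_trans k2.
    rewrite le_eqVlt; apply/orP; left; apply/eqP; apply: eq_integral => t _.
    rewrite /h !patchE; case: ifP => // _.
    by rewrite [point](_ : _ = 0)// expr0n.
exists h => //.
pose u t := f (clamp r t) - prim h t.
have cfc := continuous_clamp r0 cf.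
have cp := prim_continuous Lh.
have cu : continuous u by move=> t; apply: cvgB; [exact: cfc|exact: cp].
have uz z : C1c `]0, r[ z -> \int[mu]_(s in `]0, r[) (u s * derive1 z s) = 0.
  move=> Cz; have [dz cz [K [_ Kr zK]]] := Cz.
  have z0 : z 0 = 0 by apply: zK => /Kr /=; rewrite in_itv/= ltxx.
  have E := wk z Cz.
  have P := prim_by_parts r0 Lh dz cz.
  rewrite z0 mulr0 oppr0 add0r in P.
  have kh : \int[mu]_(t in `]0, r[) (k t * z t) = \int[mu]_(t in `]0, r[) (h t * z t).
    by apply: eq_Rintegral => t; rewrite mem_setE in_itv/= => tr; rewrite hk.
  have fE : \int[mu]_(t in `]0, r[) (f (clamp r t) * derive1 z t) =
      \int[mu]_(t in `]0, r[) (f t * derive1 z t).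
    apply: eq_Rintegral => t; rewrite mem_setE in_itv/= => /andP[t0 tr].
    by rewrite clamp_id// !ltW.
  rewrite /u; under eq_Rintegral do rewrite mulrBl.
  rewrite RintegralB//; first by rewrite fE E P kh subrr.
  - apply: continuous_integrable_itv => t.
    by apply: cvgM; [exact: cfc|exact: cz].
  - apply: continuous_integrable_itv => t.
    by apply: cvgM; [exact: cp|exact: cz].
have uc t : 0 < t < r -> u t = u (r / 2).
  move=> /andP[t0 tr].
  (* The interval [(a, b)] is compactly inside [(0, r)] and contains both [t] and the reference
     point [r/2]. *)
  pose a := Num.min t (r / 2) / 2; pose b := (Num.max t (r / 2) + r) / 2.
  have [a0 ab br] : [/\ 0 < a, a < b & b < r].
    by rewrite /a /b; split; case: (leP t (r / 2)) => ?; lra.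
  have [m mE] := du_bois_reymond cu uz a0 ab br.
  by rewrite !mE// /a /b; case: (leP t (r / 2)) => ?; lra.
have uE := continuous_cst_closure cu r0 uc.
move=> t tr; have := uE t tr; rewrite -(uE r); last by rewrite lexx ltW.
rewrite /u !clamp_id//; last by rewrite lexx ltW.
by rewrite fr (prim_ge_r Lh (lexx r)) subrr => /eqP; rewrite subr_eq0 => /eqP.
Qed.

Lemma prim_W12 (r : R) (h : R -> R) : 0 < r -> L2fun r h -> W12 0 r (prim h).
Proof.
move=> r0 Lh; have cp := prim_continuous Lh.
have mp : measurable_fun [set: R] (prim h) by exact: continuous_measurable_fun.
split.
  split; first exact: measurable_funTS.
  have : mu.-integrable `]0, r[ (EFin \o (fun t => prim h t ^+ 2)).
    by apply: continuous_integrable_itv => t; exact: (cvgM (cp t) (cp t)).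
  move=> /integrableP[_]; apply: le_lt_trans.
  rewrite le_eqVlt; apply/orP; left; apply/eqP; apply: eq_integral => t _.
  by rewrite /= ger0_norm// sqr_ge0.
have [mh h0 h2] := Lh.
exists h; first split; first exact: measurable_funTS.
  apply: le_lt_trans h2; apply: ge0_subset_integral => //.
    by apply/measurable_EFinP; exact: measurable_funX.
  by move=> t _; rewrite lee_fin sqr_ge0.
move=> z [dz cz [K [_ Kr zK]]].
have z0 : z 0 = 0 by apply: zK => /Kr /=; rewrite in_itv/= ltxx.
by rewrite (prim_by_parts r0 Lh dz cz) z0 mulr0 oppr0 add0r.
Qed.

End W12_primitives.

(** * Radial vector fields and their divergence *)

Section row_vector_calculus.
Context {R : realType}.

Lemma enorm_continuous n : continuous (@enorm R n).
Proof.
move=> x; apply: (@continuous_comp _ _ _ (fun y : 'rV[R]_n => \sum_i y ord0 i ^+ 2)).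
  apply: continuous_big; first exact: add_continuous.
  move=> i _ y; have c : {for y, continuous (fun y : 'rV[R]_n => y ord0 i)}.
    exact: coord_continuous.
  by apply: (cvgM c c).
exact: sqrt_continuous.
Qed.

(** Boundedness refers to the sup norm of the matrix space, which the Euclidean norm dominates. *)
Lemma closed_eball_compact n (r : R) : compact [set x : 'rV[R]_n | enorm x <= r].
Proof.
apply: bounded_closed_compact; last first.
  apply: (@closed_comp _ _ (@enorm R n) [set y | y <= r]); last exact: closed_le.
  by move=> x _; exact: enorm_continuous.
exists r; split; first exact: num_real.
move=> M rM x /= xr; rewrite /Num.norm/= mx_normrE.
apply: bigmax_le => [|[i j] _ /=]; last first.
  by rewrite ord1 (le_trans (coord_le_enorm x j))// (le_trans xr)// ltW.
by rewrite ltW// (le_lt_trans _ rM)// (le_trans (enorm_ge0 x)).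
Qed.

Lemma continuous_bounded_eball n (f : 'rV[R]_n -> R) (r : R) : continuous f ->
  exists M, forall x, enorm x <= r -> `|f x| <= M.
Proof.
move=> cf; have /compact_bounded[M [_ Mf]] :
    compact (f @` [set x : 'rV[R]_n | enorm x <= r]).
  apply: continuous_compact; last exact: closed_eball_compact.
  exact: continuous_subspaceT.
exists (M + 1) => x xr; apply: (Mf (M + 1)); first by rewrite ltrDl.
by exists x.
Qed.

Lemma derive_partial n (f : 'rV[R]_n -> R) (x v : 'rV[R]_n) : differentiable f x ->
  'D_v f x = \sum_i v ord0 i * partial i f x.
Proof.
move=> df; rewrite deriveE// {1}(row_sum_delta v) linear_sum/=.
by apply: eq_bigr => i _; rewrite linearZ /partial deriveE.
Qed.

Lemma is_derive_ray n (f : 'rV[R]_n -> R) (w : 'rV[R]_n) (s : R) :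
  (forall x, differentiable f x) ->
  is_derive s (1 : R) (fun t => f (t *: w)) (\sum_i w ord0 i * partial i f (s *: w)).
Proof.
move=> df; rewrite -derive_partial//.
have E : (fun h : R => h^-1 *: (((fun t => f (t *: w)) \o shift s) (h *: (1 : R)) - f (s *: w)))
    = (fun h : R => h^-1 *: ((f \o shift (s *: w)) (h *: w) - f (s *: w))).
  by apply/funext => h /=; rewrite scalerDl -scalerA scale1r.
have dfw : derivable f (s *: w) w by exact: diff_derivable.
by apply: DeriveDef; rewrite /derivable /derive E.
Qed.

End row_vector_calculus.

Section radial_integrals.
Context {R : realType} {n : nat}.
Local Notation mu := (@lebesgue_measure R).
Local Notation lr := (@lebesgue_rV R n.+1).

Lemma radial_integral_lty (r : R) (G : R -> R) :
  measurable_fun [set: R] G -> (forall s, 0 <= G s) -> G 0 = 0 ->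
  (\int[mu]_(s in `]0%R, r[) (s ^+ n * G s)%:E < +oo)%E ->
  (\int[lr]_(x in eball r) (G (enorm x))%:E < +oo)%E.
Proof.
move=> mG G0 G00 IG.
have [k k0 radial] := @radial_integral R n.
pose H s : \bar R := (if s < r then G s else 0)%:E.
have mH : measurable_fun setT H.
  by apply/measurable_EFinP; apply: measurable_fun_ifT => //; exact: measurable_fun_ltr.
have H0 s : (0 <= H s)%E by rewrite /H lee_fin; case: ifP.
have H00 : H 0 = 0%E by rewrite /H G00 if_same.
have E := radial H mH H0 H00.
have -> : (\int[lr]_(x in eball r) (G (enorm x))%:E = \int[lr]_x H (enorm x))%E.
  rewrite integral_mkcond; apply: eq_integral => x _.
  rewrite patchE /H; have [xr|xr] := ltP (enorm x) r; first by rewrite mem_set.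
  by rewrite memNset//; apply/negP; rewrite -leNgt.
rewrite E; apply: lte_mul_pinfty => //; first by rewrite lee_fin ltW.
apply: le_lt_trans IG; rewrite [leRHS]integral_mkcond.
rewrite le_eqVlt; apply/orP; left; apply/eqP; apply: eq_integral => s _.
rewrite patchE mem_setE in_itv/= /H -EFinM.
by have [s0|s0] := ltP 0 s; have [sr|sr] := ltP s r; rewrite ?mulr0 ?mul0r.
Qed.

End radial_integrals.

Section radial_divergence.
Context {R : realType}.
Local Notation mu := (@lebesgue_measure R).

(** Since [0^-1 = 0], this field is [0] at the origin, and so is [radial_div h] when [L2fun r h]
    holds; the polar formulas require such values. *)
Definition radial_field n (h : R -> R) (x : 'rV[R]_n) : 'rV[R]_n :=
  prim h (enorm x) *: ((enorm x)^-1 *: x).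

Definition radial_div n (h : R -> R) (x : 'rV[R]_n) : R :=
  h (enorm x) + n.-1%:R * (prim h (enorm x) / enorm x).

Variable r : R.
Hypothesis r0 : 0 < r.

Lemma measurable_radial_div n h : L2fun r h ->
  measurable_fun [set: 'rV[R]_n] (radial_div h).
Proof.
move=> Lh; have [mh _ _] := Lh.
have me := @measurable_enorm R n.
apply: measurable_funD; first exact: (measurableT_comp mh me).
apply: measurable_funM => //; apply: measurable_funM.
  apply: (measurableT_comp _ me); apply: continuous_measurable_fun.
  exact: prim_continuous Lh.
exact: (measurableT_comp measurable_invr me).
Qed.

Variable m : nat.
Local Notation lr := (@lebesgue_rV R m.+2).

(** As [prim h] is bounded, the singular term is at most a multiple of [1/|x|]. The weight [s^(m+1)]
    of dimension [m+2] turns it into a multiple of [s^m], bounded on [(0, r)]. *)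
Lemma integrable_radial_div h : L2fun r h ->
  lr.-integrable (eball r) (EFin \o radial_div h).
Proof.
move=> Lh; have [mh h0 _] := Lh; have [M hM] := prim_bounded Lh.
have M0 : 0 <= M by apply: le_trans (hM 0).
have mD : measurable_fun (eball r) (@radial_div m.+2 h).
  by apply: measurable_funTS; exact: measurable_radial_div.
apply/integrableP; split; first exact/measurable_EFinP.
pose G s := `|h s| + m.+1%:R * (M * `|s^-1|).
have G0 s : 0 <= G s by rewrite addr_ge0// !mulr_ge0.
have mG : measurable_fun [set: R] G.
  apply: measurable_funD; first exact: measurableT_comp.
  apply: measurable_funM => //; apply: measurable_funM => //.
  by apply: measurableT_comp => //; exact: measurable_invr.
apply: (@le_lt_trans _ _ (\int[lr]_(x in eball r) (G (enorm x))%:E)%E).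
  apply: ge0_le_integral => //.
  - exact: measurable_eball.
  - by apply: measurableT_comp => //; exact/measurable_EFinP.
  - apply/measurable_EFinP; apply: measurable_funTS.
    by apply: (measurableT_comp mG); exact: measurable_enorm.
  - move=> x _; rewrite /= lee_fin (le_trans (ler_normD _ _))// lerD2l.
    by rewrite !normrM ger0_norm// ler_wpM2l// ler_wpM2r.
apply: radial_integral_lty => //.
  by rewrite /G h0 ?ltxx// invr0 normr0 !mulr0 addr0.
have ih : mu.-integrable `]0, r[ (EFin \o h).
  exact: integrableS (L2fun_integrable Lh).
pose c := m.+1%:R * M * r ^+ m.
have ih2 : mu.-integrable `]0, r[ (EFin \o (fun s => r ^+ m.+1 * `|h s| + c)).
  have -> : EFin \o (fun s => r ^+ m.+1 * `|h s| + c) =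
    ((fun s => (r ^+ m.+1)%:E * (`|h s|)%:E) \+ (EFin \o (cst c)))%E by [].
  apply: integrableD => //.
    apply: integrableZl => //; exact: integrable_norm ih.
  by apply: continuous_integrable_itv => s; exact: cvg_cst.
have /integrableP[_] := ih2; apply: le_lt_trans; apply: ge0_le_integral => //.
- by move=> s; rewrite /= in_itv/= => /andP[s0 sr]; rewrite lee_fin mulr_ge0// exprn_ge0// ltW.
- apply/measurable_EFinP; apply: measurable_funTS; exact: measurable_funM.
- by apply: measurableT_comp => //; case/integrableP: ih2.
move=> s; rewrite /= in_itv/= => /andP[s0 sr]; rewrite lee_fin.
apply: le_trans (ler_norm _); rewrite /G /c mulrDr; apply: lerD.
  by rewrite ler_wpM2r// lerXn2r// ?nnegrE ltW.
rewrite gtr0_norm ?invr_gt0// mulrCA -!mulrA ler_wpM2l// mulrCA ler_wpM2l//.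
by rewrite exprSr mulfK ?gt_eqF// lerXn2r// ?nnegrE ltW.
Qed.

(** The divergence theorem on one ray: [W = prim h * z' + h * z] for [z s = s^(m+1) phi(s w)]. The
    boundary terms vanish because [z 0 = 0] and [prim h r = 0]. *)
Lemma radial_ray_by_parts h (phi : 'rV[R]_m.+2 -> R) (w : 'rV[R]_m.+2) :
  L2fun r h -> (forall x, differentiable phi x) ->
  (forall i, continuous (partial i phi)) ->
  let W s := s ^+ m.+1 * (prim h s * \sum_i w ord0 i * partial i phi (s *: w)
     + (h s + m.+1%:R * (prim h s / s)) * phi (s *: w)) in
  mu.-integrable `]0, r[ (EFin \o W) /\ \int[mu]_(s in `]0, r[) W s = 0.
Proof.
move=> Lh dphi cphi W.
have cw : continuous (fun s : R => s *: w) by exact: scalel_continuous.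
have cp : continuous phi by move=> x; exact: differentiable_continuous.
have cpw : continuous (fun s : R => phi (s *: w)).
  by move=> s; apply: (@continuous_comp _ _ _ (fun s : R => s *: w)); [exact: cw|exact: cp].
pose A (s : R) := \sum_i w ord0 i * partial i phi (s *: w).
have cA : continuous A.
  apply: continuous_big; first exact: add_continuous.
  move=> i _ s; apply: cvgM; first exact: cvg_cst.
  by apply: (@continuous_comp _ _ _ (fun s : R => s *: w)); [exact: cw|exact: cphi].
have cX k : continuous (fun s : R => s ^+ k) by exact: exprn_continuous.
pose z (s : R) := s ^+ m.+1 * phi (s *: w).
have zd s : is_derive s (1 : R) z (s ^+ m.+1 * A s + m.+1%:R * s ^+ m * phi (s *: w)).
  have D1 := is_derive_ray w s dphi.
  have D2 : is_derive s (1 : R) (fun t => t ^+ m.+1) (m.+1%:R * s ^+ m).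
    by apply: DeriveDef; [exact: exprn_derivable|rewrite exp_derive scaler1].
  apply: (is_derive_eq (is_deriveM D2 D1)).
  by rewrite /A; congr (_ + _); exact: mulrC.
have z'E : derive1 z = fun s => s ^+ m.+1 * A s + m.+1%:R * s ^+ m * phi (s *: w).
  by apply/funext => s; rewrite derive1E; exact: derive_val.
have dz s : derivable z s 1 by have [] := zd s.
have cz : continuous (derive1 z).
  rewrite z'E => s; apply: cvgD; first by apply: cvgM; [exact: cX|exact: cA].
  by apply: cvgM; [apply: cvgM; [exact: cvg_cst|exact: cX]|exact: cpw].
have czz : continuous z by move=> s; apply: cvgM; [exact: cX|exact: cpw].
have P := prim_by_parts r0 Lh dz cz.
have WE s : 0 < s < r -> W s = prim h s * derive1 z s + h s * z s.
  move=> /andP[s0 sr]; rewrite /W z'E /z -/(A s) exprSr; field.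
  by rewrite gt_eqF.
have I1 : mu.-integrable `]0, r[ (EFin \o (fun s => prim h s * derive1 z s)).
  apply: continuous_integrable_itv => s; apply: cvgM; last exact: cz.
  exact: prim_continuous Lh s.
have I2 : mu.-integrable `]0, r[ (EFin \o (fun s => h s * z s)).
  have [M zM] := continuous_bounded_itv 0 r czz.
  have mz : measurable_fun [set: R] z by exact: continuous_measurable_fun.
  have Ib : mu.-integrable setT (EFin \o (fun s => h s * z s)).
    apply: (@integrable_mul_bounded _ _ h z M Lh mz) => t /andP[t0 tr].
    by apply: zM; rewrite !ltW.
  exact: integrableS Ib.
split.
  have I12 : mu.-integrable `]0, r[
      (EFin \o (fun s => prim h s * derive1 z s + h s * z s)).
    by apply: (integrableD _ I1 I2).
  apply: eq_integrable I12 => //.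
  by move=> s; rewrite mem_setE in_itv/= => sr; rewrite /= WE.
transitivity (\int[mu]_(s in `]0, r[) (prim h s * derive1 z s + h s * z s)).
  by apply: eq_Rintegral => s; rewrite mem_setE in_itv/= => sr; rewrite WE.
rewrite RintegralD// P /z expr0n/= mul0r mulr0 oppr0 add0r.
by rewrite addrC subrr.
Qed.

End radial_divergence.

(** Recasts the vanishing of a signed integral as an equality of nonnegative ones, the form that
    [eq_integral_rays] can handle. *)
Lemma Rintegral_eq0P d (T : measurableType d) (R : realType)
    (m : {measure set T -> \bar R}) (D : set T) (f : T -> R) : measurable D ->
  m.-integrable D (EFin \o f) ->
  \int[m]_(x in D) f x = 0 <->
  (\int[m]_(x in D) (Num.max (f x) 0)%:E = \int[m]_(x in D) (Num.max (- f x) 0)%:E)%E.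
Proof.
move=> mD If.
have fp := integrable_fin_num mD (integrable_funepos mD If).
have fn := integrable_fin_num mD (integrable_funeneg mD If).
have E1 : (\int[m]_(x in D) (Num.max (f x) 0)%:E = \int[m]_(x in D) (EFin \o f)^\+ x)%E.
  by apply: eq_integral => x _; rewrite funeposE /= EFin_max.
have E2 : (\int[m]_(x in D) (Num.max (- f x) 0)%:E = \int[m]_(x in D) (EFin \o f)^\- x)%E.
  by apply: eq_integral => x _; rewrite funenegE /= EFin_max.
rewrite E1 E2 /Rintegral [X in fine X]integralE fineB//; split.
  by move/eqP; rewrite subr_eq0 => /eqP E; rewrite -(fineK fp) -(fineK fn) E.
by move=> ->; rewrite subrr.
Qed.

Section weak_divergence_radial.
Context {R : realType}.
Local Notation mu := (@lebesgue_measure R).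
Variables (r : R) (m : nat).
Hypothesis r0 : 0 < r.
Local Notation lr := (@lebesgue_rV R m.+2).

Lemma measurable_radial_field h (i : 'I_m.+2) : L2fun r h ->
  measurable_fun [set: 'rV[R]_m.+2] (fun x => radial_field h x ord0 i).
Proof.
move=> Lh; have me := @measurable_enorm R m.+2.
rewrite /radial_field; under eq_fun do rewrite !mxE.
apply: measurable_funM; last first.
  apply: measurable_funM; first exact: (measurableT_comp measurable_invr me).
  exact: measurable_coord.
apply: (measurableT_comp _ me); apply: continuous_measurable_fun.
exact: prim_continuous Lh.
Qed.

Lemma radial_field_bounded h : L2fun r h ->
  exists M, forall x i, `|@radial_field R m.+2 h x ord0 i| <= M.
Proof.
move=> Lh; have [M hM] := prim_bounded Lh; exists M => x i.
rewrite !mxE normrM; apply: (@le_trans _ _ (M * 1)); last by rewrite mulr1.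
apply: ler_pM => //; rewrite normrM ger0_norm ?invr_ge0 ?enorm_ge0//.
have [->|x0] := eqVneq x 0; first by rewrite mxE normr0 mulr0.
by rewrite mulrC ler_pdivrMr ?mul1r ?coord_le_enorm// enorm_gt0.
Qed.

Lemma integrable_eball_mul_bounded (f g : 'rV[R]_m.+2 -> R) (M : R) :
  lr.-integrable (eball r) (EFin \o f) -> measurable_fun [set: 'rV[R]_m.+2] g ->
  (forall x, eball r x -> `|g x| <= M) ->
  lr.-integrable (eball r) (EFin \o (fun x => f x * g x)).
Proof.
move=> If mg gM.
have I : lr.-integrable (eball r) (fun x => M%:E * (f x)%:E)%E.
  by apply: integrableZl => //; exact: measurable_eball.
apply: (le_integrable _ _ _ I); first exact: measurable_eball.
  apply/measurable_EFinP; apply: measurable_funM; last exact: measurable_funTS.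
  by case/integrableP : If => /measurable_EFinP.
move=> x rx; rewrite -EFinM /= lee_fin normrM normrM mulrC ler_wpM2r//.
by rewrite (le_trans (gM x rx))// ler_norm.
Qed.

Lemma integrable_eball_bounded (g : 'rV[R]_m.+2 -> R) (M : R) :
  measurable_fun [set: 'rV[R]_m.+2] g -> (forall x, eball r x -> `|g x| <= M) ->
  lr.-integrable (eball r) (EFin \o g).
Proof.
move=> mg gM; apply: measurable_bounded_integrable.
- exact: measurable_eball.
- exact: lebesgue_rV_eball_lty.
- exact: measurable_funTS.
- exists M; split; first exact: num_real.
  by move=> M' MM' x rx /=; rewrite (le_trans (gM x rx))// ltW.
Qed.

Section test_function.
Variables (h : R -> R) (phi : 'rV[R]_m.+2 -> R).
Hypothesis Lh : L2fun r h.
Hypothesis dphi : forall x, differentiable phi x.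
Hypothesis cphi : forall i, continuous (partial i phi).

Let F (x : 'rV[R]_m.+2) := \sum_i radial_field h x ord0 i * partial i phi x.
Let G (x : 'rV[R]_m.+2) := radial_div h x * phi x.
Let V (x : 'rV[R]_m.+2) := if enorm x < r then F x + G x else 0.

Let W (w : 'rV[R]_m.+2) (s : R) :=
  s ^+ m.+1 * (prim h s * \sum_i w ord0 i * partial i phi (s *: w)
     + (h s + m.+1%:R * (prim h s / s)) * phi (s *: w)).

Let cp : continuous phi.
Proof. by move=> x; exact: differentiable_continuous. Qed.

Let mF : measurable_fun [set: 'rV[R]_m.+2] F.
Proof.
apply: measurable_sum => i; apply: measurable_funM.
  exact: measurable_radial_field.
exact: continuous_measurable_rV.
Qed.

Let mG : measurable_fun [set: 'rV[R]_m.+2] G.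
Proof.
apply: measurable_funM; first exact: measurable_radial_div Lh.
exact: continuous_measurable_rV.
Qed.

Let mV : measurable_fun [set: 'rV[R]_m.+2] V.
Proof.
apply: measurable_fun_ifT.
    by apply: measurable_fun_ltr => //; exact: measurable_enorm.
  exact: measurable_funD.
exact: measurable_cst.
Qed.

Let iF : lr.-integrable (eball r) (EFin \o F).
Proof.
have [M fM] := radial_field_bounded Lh.
have /choice[B pB] : forall i, exists B, forall x, enorm x <= r -> `|partial i phi x| <= B.
  by move=> i; exact: continuous_bounded_eball.
apply: (@integrable_eball_bounded _ (\sum_i M * B i)) => // x /ltW xr.
rewrite (le_trans (ler_norm_sum _ _ _))//; apply: ler_sum => i _.
by rewrite normrM ler_pM// pB.
Qed.

Let iG : lr.-integrable (eball r) (EFin \o G).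
Proof.
have [M pM] := continuous_bounded_eball r cp.
apply: (@integrable_eball_mul_bounded _ _ M).
- exact: integrable_radial_div.
- exact: continuous_measurable_rV.
- by move=> x /ltW; exact: pM.
Qed.

Let V_ray (w : 'rV[R]_m.+2) (s : R) : enorm w = 1 -> 0 < s ->
  s ^+ m.+1 * V (s *: w) = if s < r then W w s else 0.
Proof.
move=> w1 s0; rewrite /V enormZ w1 mulr1 gtr0_norm//.
case: ifPn => sr; last by rewrite mulr0.
rewrite /W /F /G /radial_field /radial_div enormZ w1 mulr1 gtr0_norm//.
have -> : s^-1 *: (s *: w) = w by rewrite scalerA mulVf ?scale1r// gt_eqF.
congr (_ * (_ + _)).
by rewrite mulr_sumr; apply: eq_bigr => i _; rewrite mxE mulrA.
Qed.

(** Meant for [o] the positive or negative part: positive homogeneity lets [o] absorb the weight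
    [s^(m+1)]. *)
Let V_part (o : R -> R) : measurable_fun [set: R] o -> (forall t, 0 <= o t) ->
  (forall c t, 0 <= c -> o (c * t) = c * o t) ->
  forall w, enorm w = 1 ->
  ray_integral (fun x => (o (V x))%:E) w =
  (\int[mu]_(s in `]0%R, r[) (o (W w s))%:E)%E.
Proof.
move=> mo o0 oM w w1; rewrite /ray_integral [RHS]integral_mkcond.
have o00 : o 0 = 0 by have := oM 0 0 (lexx 0); rewrite !mul0r.
apply: eq_integral => s _; rewrite patchE mem_setE in_itv/= -EFinM.
have [s0|s0] := ltP 0 s; last by rewrite mul0r.
rewrite -oM ?exprn_ge0 ?ltW// V_ray//=.
by case: ifP => // _; rewrite o00.
Qed.

(** By [radial_ray_by_parts] the positive and negative parts of the sum of the two integrands have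
    equal integrals on every ray, hence over the ball. *)
Lemma radial_field_by_parts :
  \int[lr]_(x in eball r) (\sum_i radial_field h x ord0 i * partial i phi x) =
  - \int[lr]_(x in eball r) (radial_div h x * phi x).
Proof.
pose op (t : R) := Num.max t 0; pose on (t : R) := Num.max (- t) 0.
have mop : measurable_fun [set: R] op by exact: measurable_maxr.
have mon : measurable_fun [set: R] on.
  by apply: measurable_maxr => //; exact: oppr_measurable.
have op0 t : 0 <= op t by rewrite le_max lexx orbT.
have on0 t : 0 <= on t by rewrite le_max lexx orbT.
have opM c t : 0 <= c -> op (c * t) = c * op t.
  by move=> c0; rewrite /op maxr_pMr// mulr0.
have onM c t : 0 <= c -> on (c * t) = c * on t.
  by move=> c0; rewrite /on maxr_pMr// mulr0 mulrN.
have V0 : V 0 = 0.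
  rewrite /V enorm0 r0 /F /G /radial_div big1 => [|i _]; last first.
    by rewrite /radial_field scaler0 scaler0 mxE mul0r.
  have [_ h0 _] := Lh.
  by rewrite enorm0 invr0 mulr0 mulr0 addr0 add0r h0 ?mul0r// ltxx.
have E : (\int[lr]_x (op (V x))%:E = \int[lr]_x (on (V x))%:E)%E.
  apply: eq_integral_rays.
  - by apply/measurable_EFinP; exact: (measurableT_comp mop mV).
  - by apply/measurable_EFinP; exact: (measurableT_comp mon mV).
  - by move=> x; rewrite lee_fin.
  - by move=> x; rewrite lee_fin.
  - by rewrite V0 /op maxxx.
  - by rewrite V0 /on oppr0 maxxx.
  move=> w w1; rewrite !V_part//.
  have [iW W0] := radial_ray_by_parts r0 w Lh dphi cphi.
  exact/(Rintegral_eq0P _ iW).1.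
have iV : lr.-integrable (eball r) (EFin \o (fun x => F x + G x)).
  by apply: (integrableD _ iF iG); exact: measurable_eball.
have VE (o : R -> R) : o 0 = 0 ->
    (\int[lr]_(x in eball r) (o (F x + G x))%:E = \int[lr]_x (o (V x))%:E)%E.
  move=> o00; rewrite integral_mkcond; apply: eq_integral => x _; rewrite patchE /V.
  have [xr|xr] := ltP (enorm x) r; first by rewrite mem_set.
  by rewrite memNset ?o00//; apply/negP; rewrite -leNgt.
have : \int[lr]_(x in eball r) (F x + G x) = 0.
  apply/(Rintegral_eq0P _ iV); first exact: measurable_eball.
  rewrite (VE op) ?(VE on)//; first by rewrite /on oppr0 maxxx.
  by rewrite /op maxxx.
rewrite RintegralD//; last exact: measurable_eball.
by move=> /eqP; rewrite addr_eq0 => /eqP.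
Qed.

End test_function.

End weak_divergence_radial.

Section weak_divergence_of_radial_fields.
Context {R : realType}.
Variables (r : R) (m : nat).
Hypothesis r0 : 0 < r.
Local Notation lr := (@lebesgue_rV R m.+2).

Lemma ae_eq_off_0 (f g : 'rV[R]_m.+2 -> \bar R) (D : set 'rV[R]_m.+2) :
  (forall x, D x -> x != 0 -> f x = g x) -> ae_eq lr D f g.
Proof.
move=> fg; have N0 : lr.-negligible [set 0 : 'rV[R]_m.+2].
  exists [set 0]; split => //; last exact: lebesgue_rV_set1_0.
  by apply: compact_measurable_rV; exact: compact_set1.
apply: negligibleS N0 => x /= /not_implyP[Dx]; apply: contra_notP => /eqP x0.
exact: fg.
Qed.

(** Admissible fields are arbitrary at the origin, so measurability must tolerate any value
    there. *)
Lemma measurable_fun_off_0 (f g : 'rV[R]_m.+2 -> R) (D : set 'rV[R]_m.+2) :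
  measurable_fun [set: 'rV[R]_m.+2] g ->
  (forall x, D x -> x != 0 -> f x = g x) -> measurable_fun D f.
Proof.
move=> mg fg.
apply: (@eq_measurable_fun _ _ _ _ D (fun x => if enorm x == 0 then f 0 else g x)).
  move=> x /set_mem Dx; rewrite enorm_eq0.
  by have [->//|x0] := eqVneq x 0; rewrite fg.
apply: measurable_funTS; apply: measurable_fun_ifT => //.
by apply: measurable_fun_eqr => //; exact: measurable_enorm.
Qed.

Lemma weak_divergence_radial h (z : 'rV[R]_m.+2 -> 'rV[R]_m.+2) : L2fun r h ->
  (forall x, eball r x -> x != 0 -> z x = radial_field h x) ->
  weak_divergence (eball r) z (radial_div h).
Proof.
move=> Lh zE; split.
  split; first by apply: measurable_funTS; exact: measurable_radial_div Lh.
  move=> K cK KU.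
  have /integrableP[mf] := @integrable_radial_div _ _ r0 m _ Lh.
  apply: le_lt_trans; apply: ge0_subset_integral => //.
  - exact: compact_measurable_rV.
  - exact: measurable_eball.
  - apply/measurable_EFinP; apply: measurableT_comp => //; exact/measurable_EFinP.
move=> phi [dphi cphi _].
rewrite -(radial_field_by_parts r0 Lh dphi cphi).
pose f x := \sum_i z x ord0 i * partial i phi x.
pose g x := \sum_i radial_field h x ord0 i * partial i phi x.
have fg x : eball r x -> x != 0 -> f x = g x.
  by move=> rx x0; apply: eq_bigr => i _; rewrite zE.
have mg : measurable_fun [set: 'rV[R]_m.+2] g.
  apply: measurable_sum => i; apply: measurable_funM.
    exact: measurable_radial_field Lh.
  exact: continuous_measurable_rV.
congr fine; apply: ae_eq_integral.
- exact: measurable_eball.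
- by apply/measurable_EFinP; exact: measurable_fun_off_0 mg fg.
- by apply/measurable_EFinP; exact: measurable_funTS.
- by apply: ae_eq_off_0 => x rx x0; congr EFin; exact: fg.
Qed.

End weak_divergence_of_radial_fields.

(** * Uniqueness of the weak divergence *)

Section C1_functions.
Context {R : realType}.

(** A quadratic remainder estimate spares one-sided limits at the point where [sqr_pos] changes
    formula. *)
Lemma is_derive_quadratic (f : R -> R) (x L C : R) :
  (forall h, `|f (x + h) - f x - L * h| <= C * h ^+ 2) -> is_derive x (1 : R) f L.
Proof.
move=> fC.
have cvgL : (fun h : R => h^-1 *: ((f \o shift x) (h *: (1 : R)) - f x)) @ 0^' --> L.
  apply/cvgrPdist_le => e e0.
  have C0 : 0 < `|C| + 1 by rewrite ltr_wpDl.
  have ec : 0 < e / (`|C| + 1) by rewrite divr_gt0.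
  near=> h.
  have h0 : h != 0 by near: h; exact: nbhs_dnbhs_neq.
  have hC : `|h| <= e / (`|C| + 1).
    near: h; apply: dnbhs0_le => //.
  rewrite /= distrC [h *: 1]mulr1 [h + x]addrC.
  have -> : h^-1 *: (f (x + h) - f x) - L = h^-1 * (f (x + h) - f x - L * h).
    by rewrite mulrBr [L * h]mulrC mulrA mulVf ?mul1r.
  rewrite normrM normfV mulrC ler_pdivrMr ?normr_gt0//.
  apply: le_trans (fC h) _.
  rewrite -[h ^+ 2]real_normK ?num_real// expr2 mulrA ler_wpM2r//.
  apply: (@le_trans _ _ ((`|C| + 1) * `|h|)).
    by rewrite ler_wpM2r// (le_trans (ler_norm C))// lerDl.
  by rewrite mulrC -ler_pdivlMr.
by apply: DeriveDef; [apply/cvg_ex; exists L|exact: cvg_lim cvgL].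
Unshelve. all: by end_near. Qed.

(** A [C^1] function whose zero set is the half-line [t <= 0]; it yields both compactly supported
    cut-offs and half-spaces as zero sets. *)
Definition sqr_pos (t : R) : R := Num.max t 0 ^+ 2.

Lemma is_derive_sqr_pos (t : R) : is_derive t (1 : R) sqr_pos (2 * Num.max t 0).
Proof.
apply: (@is_derive_quadratic _ _ _ 1) => h; rewrite mul1r /sqr_pos.
case: (leP t 0) => t0; case: (leP (t + h) 0) => th.
- by rewrite expr0n/= mulr0 mul0r !subr0 normr0 sqr_ge0.
- rewrite expr0n/= mulr0 mul0r !subr0 ger0_norm ?sqr_ge0//.
  by rewrite ler_sqr ?nnegrE; lra.
- by rewrite expr0n/= ler_norml; nra.
- have -> : (t + h) ^+ 2 - t ^+ 2 - 2 * t * h = h ^+ 2 by ring.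
  by rewrite ger0_norm ?sqr_ge0.
Qed.

Lemma sqr_pos_eq0 t : (sqr_pos t == 0) = (t <= 0).
Proof. by rewrite sqrf_eq0; case: (leP t 0) => ?; rewrite ?eqxx// gt_eqF. Qed.

Lemma sqr_pos_derivable t : derivable sqr_pos t 1.
Proof. by have [] := is_derive_sqr_pos t. Qed.

Lemma continuous_derive1_sqr_pos : continuous (derive1 sqr_pos).
Proof.
have -> : derive1 sqr_pos = fun t => 2 * Num.max t 0.
  by apply/funext => t; rewrite derive1E; have [_ ->] := is_derive_sqr_pos t.
have -> : (fun t : R => 2 * Num.max t 0) = (fun t => t + `|t|).
  by apply/funext => t; case: (ger0P t) => t0; rewrite ?(max_idPl t0) ?(max_idPr (ltW t0)); ring.
by move=> t; apply: cvgD; [exact: cvg_id|exact: norm_continuous].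
Qed.

Definition C1 n (f : 'rV[R]_n -> R) : Prop :=
  (forall x, differentiable f x) /\ (forall i, continuous (partial i f)).

Lemma C1_continuous n (f : 'rV[R]_n -> R) : C1 f -> continuous f.
Proof. by move=> [df _] x; exact: differentiable_continuous. Qed.

Lemma C1_cst n (c : R) : C1 (cst c : 'rV[R]_n -> R).
Proof.
split => [x|i]; first exact: differentiable_cst.
have -> : partial i (cst c : 'rV[R]_n -> R) = cst 0.
  by apply/funext => x; rewrite /partial derive_cst.
by move=> x; exact: (@cst_continuous _ _ _ x).
Qed.

Lemma C1_coord n (j : 'I_n) : C1 (fun x : 'rV[R]_n => x ord0 j).
Proof.
split => [x|i]; first exact: differentiable_coord.
have -> : partial i (fun x : 'rV[R]_n => x ord0 j) = cst ((j == i)%:R).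
  apply/funext => x; rewrite /partial.
  have D := @differentiable_coord _ _ _ x ord0 j.
  apply: cvg_lim => //.
  apply: (@cvg_trans _ (cst (j == i)%:R @ 0^')); last exact: cvg_cst.
  apply: near_eq_cvg; near=> h.
  have h0 : h != 0 by near: h; exact: nbhs_dnbhs_neq.
  by rewrite /= !mxE addrK eqxx/= scalerA mulVf// scale1r.
by move=> x; exact: (@cst_continuous _ _ _ x).
Unshelve. all: by end_near. Qed.

Lemma C1_add n (f g : 'rV[R]_n -> R) : C1 f -> C1 g -> C1 (fun x => f x + g x).
Proof.
move=> [df cf] [dg cg]; split => [x|i]; first exact: differentiableD.
have -> : partial i (fun x => f x + g x) = (fun x => partial i f x + partial i g x).
  by apply/funext => x; apply: deriveD; exact: diff_derivable.
by move=> x; exact: (cvgD (cf i x) (cg i x)).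
Qed.

Lemma C1_mul n (f g : 'rV[R]_n -> R) : C1 f -> C1 g -> C1 (fun x => f x * g x).
Proof.
move=> Cf Cg; have [df cf] := Cf; have [dg cg] := Cg.
split => [x|i]; first exact: differentiableM.
have -> : partial i (fun x => f x * g x) =
    (fun x => f x * partial i g x + g x * partial i f x).
  by apply/funext => x; apply: deriveM; exact: diff_derivable.
have cf0 := C1_continuous Cf; have cg0 := C1_continuous Cg.
move=> x.
have A1 : (f y * partial i g y) @[y --> x] --> f x * partial i g x.
  exact: (cvgM (cf0 x) (cg i x)).
have A2 : (g y * partial i f y) @[y --> x] --> g x * partial i f x.
  exact: (cvgM (cg0 x) (cf i x)).
exact: (cvgD A1 A2).
Qed.

Lemma C1_comp n (T : R -> R) (f : 'rV[R]_n -> R) :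
  (forall t, derivable T t 1) -> continuous (derive1 T) -> C1 f ->
  C1 (fun x => T (f x)).
Proof.
move=> dT cT Cf; have [df cf] := Cf.
have dT' t : differentiable T t by apply/derivable1_diffP.
split => [x|i]; first exact: differentiable_comp.
have -> : partial i (fun x => T (f x)) = (fun x => partial i f x * derive1 T (f x)).
  apply/funext => x; rewrite /partial deriveE; last exact: differentiable_comp.
  have -> : 'd (fun y => T (f y)) x = 'd T (f x) \o 'd f x :> ('rV[R]_n -> R).
    exact: diff_comp.
  by rewrite /= diff1E// deriveE.
have cf0 := C1_continuous Cf; move=> x.
have cTf : {for x, continuous (fun x => derive1 T (f x))}.
  by apply: (@continuous_comp _ _ _ f); [exact: cf0|exact: cT].
exact: (cvgM (cf i x) cTf).
Qed.

Lemma C1_sum n (I : Type) (s : seq I) (f : I -> 'rV[R]_n -> R) :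
  (forall i, C1 (f i)) -> C1 (fun x => \sum_(i <- s) f i x).
Proof.
move=> Cf; elim: s => [|i s IH].
  by under eq_fun do rewrite big_nil; exact: C1_cst.
by under eq_fun do rewrite big_cons; exact: C1_add.
Qed.

Lemma C1_expN n (f : 'rV[R]_n -> R) (k : R) : C1 f ->
  C1 (fun x => expR (- k * f x ^+ 2)).
Proof.
move=> Cf; apply: (@C1_comp _ expR (fun x => - k * f x ^+ 2)).
- by move=> t; exact: derivable_expR.
- have -> : derive1 (@expR R) = expR.
    by apply/funext => t; rewrite derive1E derive_val.
  exact: continuous_expR.
- apply: C1_mul; first exact: C1_cst.
  exact: C1_mul.
Qed.

(** A [C^1] cut-off, for [s > 0] positive exactly on the open ball of radius [s]. The norm enters
    squared because it is not differentiable at the origin. *)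
Definition bump n (s : R) (x : 'rV[R]_n) : R := sqr_pos (s ^+ 2 - enorm x ^+ 2).

Lemma C1_bump n (s : R) : C1 (@bump n s).
Proof.
apply: C1_comp => [t||]; first exact: sqr_pos_derivable.
  exact: continuous_derive1_sqr_pos.
have -> : (fun x : 'rV[R]_n => s ^+ 2 - enorm x ^+ 2) =
    (fun x => s ^+ 2 + -1 * \sum_i x ord0 i * x ord0 i).
  by apply/funext => x; rewrite sqr_enorm mulN1r.
apply: C1_add; first exact: C1_cst.
apply: C1_mul; first exact: C1_cst.
by apply: C1_sum => i; apply: C1_mul; exact: C1_coord.
Qed.

Lemma bump_eq0 n (s : R) (x : 'rV[R]_n) : 0 < s -> (bump s x == 0) = (s <= enorm x).
Proof.
move=> s0; rewrite sqr_pos_eq0 subr_le0 ler_pXn2r// ?nnegrE ?enorm_ge0//.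
exact: ltW.
Qed.

End C1_functions.

Section fundamental_lemma.
Context {R : realType} {n : nat}.
Local Notation lr := (@lebesgue_rV R n).

Let zero_sets : set (set 'rV[R]_n) :=
  [set A | exists2 psi, C1 psi & A = [set x | psi x = 0]].

(** The common zeros of [f] and [g] are the zeros of [f^2 + g^2]. *)
Let zero_setsI : setI_closed zero_sets.
Proof.
move=> _ _ [f Cf ->] [g Cg ->].
exists (fun x => f x * f x + g x * g x); first by apply: C1_add; exact: C1_mul.
apply/seteqP; split => x /=; first by move=> [-> ->]; rewrite !mul0r addr0.
move=> /eqP; rewrite -!expr2 paddr_eq0 ?sqr_ge0// !sqrf_eq0.
by move=> /andP[/eqP -> /eqP ->].
Qed.

(** The closed half-space [x_i >= c] is the zero set of [sqr_pos (c - x_i)], and such half-spaces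
    generate the product sigma-algebra. Conversely, zero sets of continuous functions are
    measurable. *)
Let measurable_zero_sets : @measurable _ ('rV[R]_n) = <<s zero_sets >>.
Proof.
apply/seteqP; split; last first.
  apply: smallest_sub; first exact: sigma_algebra_measurable.
  move=> _ [f Cf ->].
  have mf := continuous_measurable_rV (C1_continuous Cf).
  by have := mf measurableT [set 0] (measurable_set1 0); rewrite setTI.
apply: smallest_sub; first exact: smallest_sigma_algebra.
rewrite -bigcup_seq => _ [i /= _ [C mC <-]].
pose coor (x : g_sigma_algebraType zero_sets) : R := (x : 'rV[R]_n) ord0 i.
suff : measurable_fun setT coor by move=> /(_ measurableT C mC).
apply: (measurability _ (RGenCInfty.measurableE R)) => _ [_ [c ->] <-].
apply: sub_sigma_algebra; exists (fun x => sqr_pos (c + -1 * x ord0 i)).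
  apply: C1_comp; [exact: sqr_pos_derivable|exact: continuous_derive1_sqr_pos|].
  apply: C1_add; first exact: C1_cst.
  by apply: C1_mul; [exact: C1_cst|exact: C1_coord].
rewrite setTI; apply/seteqP; split => x /=; rewrite in_itv/= andbT /coor.
  by move=> cx; apply/eqP; rewrite sqr_pos_eq0 mulN1r subr_le0.
by move=> /eqP; rewrite sqr_pos_eq0 mulN1r subr_le0.
Qed.

(* As [k] tends to infinity, [f] integrates to [0] over every zero set of a [C^1]
   function; these form a pi-system generating the Borel sets. *)
Lemma ae_eq0_of_C1 (f : 'rV[R]_n -> R) : lr.-integrable setT (EFin \o f) ->
  (forall psi (k : nat), C1 psi -> \int[lr]_x (f x * expR (- k%:R * psi x ^+ 2)) = 0) ->
  ae_eq lr setT (EFin \o f) (cst 0%E).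
Proof.
move=> If f0; have mf : measurable_fun setT f.
  by case/integrableP : If => /measurable_EFinP.
have mA A : <<s zero_sets >> A -> measurable A by rewrite measurable_zero_sets.
have zP (A : set 'rV[R]_n) : zero_sets A -> (\int[lr]_(x in A) (f x)%:E = 0)%E.
  move=> ZA; have [psi Cpsi AE] := ZA.
  have mAA : measurable A by apply: mA; exact: sub_sigma_algebra.
  pose f_ (k : nat) x := (f x * expR (- k%:R * psi x ^+ 2))%:E.
  have mexp k : measurable_fun setT (fun x => expR (- k%:R * psi x ^+ 2)).
    by apply: continuous_measurable_rV; apply: C1_continuous; exact: C1_expN.
  have exp1 k x : expR (- k%:R * psi x ^+ 2) <= 1.
    by rewrite -expR0 ler_expR mulNr oppr_le0 mulr_ge0// sqr_ge0.
  have mf_ k : measurable_fun setT (f_ k).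
    by apply/measurable_EFinP; exact: measurable_funM.
  have I0 k : (\int[lr]_x f_ k x = 0)%E.
    have Ik : lr.-integrable setT (f_ k).
      apply: (le_integrable _ _ _ If) => // x _.
      by rewrite /= lee_fin normrM ler_piMr// gtr0_norm ?expR_gt0.
    by rewrite -[LHS]fineK ?(integrable_fin_num _ Ik)// [fine _]f0.
  (* The factor [exp(- k psi^2)] is [1] on the zero set and tends to [0] off it, so dominated
     convergence with bound [|f|] isolates the integral over [A]. *)
  have cvf x : setT x -> (fun k => f_ k x) @ \oo --> (EFin \o f) \_ A x.
    move=> _; rewrite patchE; case: ifPn => [/set_mem|/negP]; rewrite AE/=.
      move=> p0; rewrite /f_; under eq_fun do rewrite p0 expr0n/= mulr0 expR0 mulr1.
      exact: cvg_cst.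
    move=> pn0; have p0 : psi x != 0 by apply/eqP => p0; apply: pn0; exact/mem_set.
    apply: cvg_EFin; first exact: nearW.
    rewrite -[0](mulr0 (f x)); apply: cvgM; first exact: cvg_cst.
    have -> : (fun k : nat => expR (- k%:R * psi x ^+ 2)) =
        (fun k => expR (- psi x ^+ 2) ^+ k).
      by apply/funext => k; rewrite -expRM_natl mulNr mulrN.
    apply: cvg_expr; rewrite gtr0_norm ?expR_gt0// expR_lt1 oppr_lt0.
    by rewrite exprn_even_gt0.
  have gfin x : setT x -> `|f x|%:E \is a fin_num by [].
  have ig : lr.-integrable setT (fun x => `|f x|%:E) by exact: integrable_norm If.
  have abs_f k x : setT x -> (`|f_ k x| <= `|f x|%:E)%E.
    move=> _; rewrite /= lee_fin normrM ler_piMr//.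
    by rewrite gtr0_norm ?expR_gt0.
  have := dominated_cvg measurableT mf_ cvf gfin ig abs_f.
  under eq_cvg do rewrite I0.
  by rewrite -integral_mkcond => /(cvg_unique _ (cvg_cst (0%E : \bar R))) <-.
have zPT : (\int[lr]_x (f x)%:E = 0)%E.
  have -> : [set: 'rV[R]_n] = [set x | (cst 0 : _ -> R) x = 0] by apply/seteqP; split.
  by apply: zP; exists (cst 0) => //; exact: C1_cst.
(* Dynkin's pi-lambda argument; [zPT] is needed for complements. *)
have all0 A : measurable A -> (\int[lr]_(x in A) (f x)%:E = 0)%E.
  rewrite measurable_zero_sets; move: A.
  apply: (dynkin_induction measurable_zero_sets zero_setsI) => //.
  - move=> S mS S0; move: zPT; rewrite -(setUv S) integral_setU//.
    + by rewrite S0 add0e.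
    + exact: measurableC.
    + by apply/measurable_EFinP; exact: measurable_funTS.
    + by apply/disj_setPCl.
  - move=> F mF tF F0; rewrite integral_bigcup//; first by rewrite eseries0.
    by apply: integrableS If => //; exact: bigcupT_measurable.
apply: integral_ae_eq => // E _ mE.
by rewrite all0// integral0.
Qed.

End fundamental_lemma.

Section weak_divergence_uniqueness.
Context {R : realType} {n : nat}.
Local Notation lr := (@lebesgue_rV R n).

Lemma bump_out (s : R) (x : 'rV[R]_n) : 0 < s -> ~ enorm x <= s -> bump s x = 0.
Proof.
move=> s0 /negP; rewrite -ltNge => sx; apply/eqP.
by rewrite bump_eq0// ltW.
Qed.

Lemma C1c_bump (r s : R) (f : 'rV[R]_n -> R) : 0 < s -> s < r -> C1 f ->
  C1c_rV (eball r) (fun x => bump s x * f x).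
Proof.
move=> s0 sr Cf; have [db cb] := C1_mul (C1_bump n s) Cf; split => //.
exists [set x | enorm x <= s]; split.
- exact: closed_eball_compact.
- by move=> x /= xs; exact: le_lt_trans sr.
- by move=> x /= xs; rewrite bump_out// mul0r.
Qed.

Lemma integrable_bump (r s : R) (d : 'rV[R]_n -> R) : 0 < s -> s < r ->
  locally_integrable_rV (eball r) d ->
  lr.-integrable setT (EFin \o (fun x => d x * bump s x)).
Proof.
move=> s0 sr [md Id]; pose K := [set x : 'rV[R]_n | enorm x <= s].
have cK : compact K by exact: closed_eball_compact.
have mK : measurable K by exact: compact_measurable_rV.
have KU : K `<=` eball r by move=> x /= xs; exact: le_lt_trans sr.
have mdK : measurable_fun K d by apply: measurable_funS md => //; exact: measurable_eball.
have IK : lr.-integrable K (EFin \o d).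
  by apply/integrableP; split; [exact/measurable_EFinP|exact: Id].
have cb := C1_continuous (C1_bump n s).
have [M bM] := continuous_bounded_eball s cb.
have I : lr.-integrable K (fun x => M%:E * (d x)%:E)%E by exact: integrableZl.
have I2 : lr.-integrable K (EFin \o (fun x => d x * bump s x)).
  apply: (le_integrable _ _ _ I) => //.
    apply/measurable_EFinP; apply: measurable_funM => //.
    by apply: measurable_funTS; exact: continuous_measurable_rV.
  move=> x xs; rewrite -EFinM /comp !abse_EFin lee_fin (normrM (d x)) (normrM M) mulrC ler_wpM2r//.
  by rewrite (le_trans (bM x xs))// ler_norm.
have -> : EFin \o (fun x => d x * bump s x) =
    (EFin \o (fun x => d x * bump s x)) \_ K.
  apply/funext => x; rewrite patchE; case: ifPn => // /negP xK.
  rewrite /= bump_out ?mulr0// => xs; apply: xK; exact/mem_set.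
exact/(integrable_mkcond _ mK).1.
Qed.

(** For [s < r] the functions [bump s * exp(- k psi^2)] are admissible tests for every [C^1]
    function [psi]. So [ae_eq0_of_C1] applies to [(d1 - d2) * bump s], and [bump s] is nonzero on
    the ball of radius [s]. Countably many such balls exhaust the ball of radius [r]. *)
Lemma weak_divergence_unique (r : R) (z : 'rV[R]_n -> 'rV[R]_n)
    (d1 d2 : 'rV[R]_n -> R) : 0 < r ->
  weak_divergence (eball r) z d1 -> weak_divergence (eball r) z d2 ->
  {ae lr, forall x, eball r x -> d1 x = d2 x}.
Proof.
move=> r0 [L1 E1] [L2 E2].
have ball_ae (s : R) : 0 < s -> s < r -> {ae lr, forall x, eball s x -> d1 x = d2 x}.
  move=> s0 sr.
  have I1 := integrable_bump s0 sr L1; have I2 := integrable_bump s0 sr L2.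
  pose f x := d1 x * bump s x - d2 x * bump s x.
  have If : lr.-integrable setT (EFin \o f) by exact: (integrableB measurableT I1 I2).
  have f0 psi (k : nat) : C1 psi ->
      \int[lr]_x (f x * expR (- k%:R * psi x ^+ 2)) = 0.
    move=> Cpsi; pose e x := expR (- k%:R * psi x ^+ 2).
    have Ce : C1 e by exact: C1_expN.
    have Cphi := C1c_bump s0 sr Ce.
    have /(congr1 -%R) := etrans (esym (E1 _ Cphi)) (E2 _ Cphi).
    rewrite !opprK Rintegral_mkcond [RHS]Rintegral_mkcond => E.
    have Ie d : lr.-integrable setT (EFin \o (fun x => d x * bump s x)) ->
        lr.-integrable setT (EFin \o (fun x => d x * bump s x * e x)).
      move=> I; apply: (le_integrable _ _ _ I) => //.
        apply/measurable_EFinP; apply: measurable_funM.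
          by case/integrableP : I => /measurable_EFinP.
        by apply: continuous_measurable_rV; exact: C1_continuous.
      move=> x _; rewrite /comp !abse_EFin lee_fin (normrM _ (e x)) ler_piMr// gtr0_norm ?expR_gt0//.
      by rewrite -expR0 ler_expR mulNr oppr_le0 mulr_ge0// sqr_ge0.
    have Ee (d : 'rV[R]_n -> R) : \int[lr]_x (d x * bump s x * e x) =
        \int[lr]_x ((fun x => d x * (bump s x * e x)) \_ (eball r)) x.
      apply: eq_Rintegral => x _; rewrite patchE -mulrA; case: ifPn => // /negP xr.
      rewrite bump_out ?mul0r ?mulr0// => xs.
      by apply: xr; apply/mem_set; exact: le_lt_trans sr.
    under eq_Rintegral do rewrite /f mulrBl -/(e _).
    by rewrite RintegralB// ?Ee ?E ?subrr//; exact: Ie.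
  have := ae_eq0_of_C1 If f0.
  apply: filterS => x /(_ I)/= [] fx xs.
  have b0 : bump s x != 0 by rewrite bump_eq0// -ltNge.
  apply/eqP; rewrite -subr_eq0; move/eqP: fx; rewrite /f -mulrBl mulf_eq0.
  by rewrite (negbTE b0) orbF.
(* The shift [k.+2] makes the first radius [r/2], so that all radii lie strictly between [0] and
   [r]. *)
pose s_ (k : nat) : R := r * (1 - k.+2%:R^-1).
have s0 k : 0 < s_ k.
  by rewrite mulr_gt0// subr_gt0 invf_lt1 ?ltr1n.
have sr k : s_ k < r by rewrite gtr_pMr// gtrBl invr_gt0.
have := @negligible_bigcup _ _ _ lr (fun k => ~` [set x | eball (s_ k) x -> d1 x = d2 x])
  (fun k => ball_ae _ (s0 k) (sr k)).
apply: negligibleS => x /= /not_implyP[xr d12].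
have [k xk] : exists k, enorm x < s_ k.
  have e0 : 0 < 1 - enorm x / r by rewrite subr_gt0 ltr_pdivrMr// mul1r.
  have [k _ /(_ k.+1 (leqnSn _)) ke] := near_infty_natSinv_lt (PosNum e0).
  by exists k; rewrite /s_ mulrC -ltr_pdivrMr//; rewrite ltrBrDr addrC -ltrBrDr.
by exists k => //= H; apply: d12; exact: H.
Qed.

End weak_divergence_uniqueness.

(** * Reduction to profiles *)

Section radial_reduction.
Context {R : realType}.
Variables (r : R) (m : nat).
Hypothesis r0 : 0 < r.
Local Notation lr := (@lebesgue_rV R m.+2).

Lemma admissible_prim lam (z : 'rV[R]_m.+2 -> 'rV[R]_m.+2) : admissible r lam z ->
  exists h, [/\ L2fun r h,
    forall t, 0 < t < r -> `|prim h t| <= lam &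
    forall x, eball r x -> x != 0 -> z x = radial_field h x].
Proof.
move=> [f [Wf cf fr flam zf]].
have [h Lh fh] := W12_prim r0 Wf cf fr; exists h; split => // [t /andP[t0 tr]|x rx x0].
  by rewrite -fh ?flam ?t0// !ltW.
by rewrite zf// /radial_field fh// enorm_ge0 ltW.
Qed.

Lemma admissible_radial_field lam h : L2fun r h ->
  (forall t, 0 < t < r -> `|prim h t| <= lam) ->
  admissible r lam (@radial_field R m.+2 h).
Proof.
move=> Lh hlam; exists (prim h); split => //.
- exact: prim_W12.
- by apply: continuous_subspaceT; exact: prim_continuous Lh.
- exact: prim_ge_r Lh (lexx r).
Qed.

(** Since [radial_div h] is a weak divergence, [xget] does select one, and uniqueness makes it equal
    to [radial_div h] almost everywhere. *)
Lemma dual_energy_radial (g : 'rV[R]_m.+2 -> R) h (z : 'rV[R]_m.+2 -> 'rV[R]_m.+2) :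
  measurable_fun (eball r) g -> L2fun r h ->
  (forall x, eball r x -> x != 0 -> z x = radial_field h x) ->
  dual_energy r g z =
  (\int[lr]_(x in eball r) ((radial_div h x + g x) ^+ 2)%:E)%E.
Proof.
move=> mg Lh zh; have wd := weak_divergence_radial r0 Lh zh.
have wD : weak_divergence (eball r) z (divergence (eball r) z).
  by apply: xgetPex; exists (radial_div h).
have mD : measurable_fun (eball r) (divergence (eball r) z) by case: wD => -[].
apply: ae_eq_integral.
- exact: measurable_eball.
- by apply/measurable_EFinP; apply: measurable_funX; exact: measurable_funD.
- apply/measurable_EFinP; apply: measurable_funX; apply: measurable_funD => //.
  by apply: measurable_funTS; exact: measurable_radial_div Lh.
- have := weak_divergence_unique r0 wD wd.
  by apply: filterS => x /= E xr; rewrite E.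
Qed.

Lemma dual_minimizer_prim lam (g : 'rV[R]_m.+2 -> R) z :
  measurable_fun (eball r) g -> dual_minimizer r g lam z ->
  exists h, [/\ L2fun r h,
    forall t, 0 < t < r -> `|prim h t| <= lam,
    forall x, eball r x -> x != 0 -> z x = radial_field h x &
    forall k, L2fun r k -> (forall t, 0 < t < r -> `|prim k t| <= lam) ->
      (\int[lr]_(x in eball r) ((radial_div h x + g x) ^+ 2)%:E <=
       \int[lr]_(x in eball r) ((radial_div k x + g x) ^+ 2)%:E)%E].
Proof.
move=> mg [Az zmin]; have [h [Lh hlam zh]] := admissible_prim Az.
exists h; split; [exact: Lh|exact: hlam|exact: zh|move=> k Lk klam].
have Ek := dual_energy_radial mg Lk (fun x _ _ => erefl (radial_field k x)).
rewrite -(dual_energy_radial mg Lh zh) -Ek.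
by apply: zmin; exact: admissible_radial_field.
Qed.

End radial_reduction.

(** * Comparison of the minimizers *)

Section truncation.
Context {R : realType}.
Local Notation mu := (@lebesgue_measure R).

(** The point [a] is the largest element of the compact set of points of [[x, y]] where [F <= 0]. *)
Lemma last_zero (F : R -> R) (x y : R) : continuous F -> x < y -> F x < 0 -> 0 < F y ->
  exists a, [/\ x < a < y, F a = 0 & forall s, a < s <= y -> 0 < F s].
Proof.
move=> cF xy Fx Fy.
pose S := `[x, y]%classic `&` [set s | F s <= 0].
have cS : compact S.
  apply: (@subclosed_compact _ _ `[x, y]%classic); last 2 first.
  - exact: segment_compact.
  - by move=> s [].
  apply: closedI; first exact: itv_closed.
  by apply: (@closed_comp _ _ F [set y | y <= 0]); [move=> s _; exact: cF|exact: closed_le].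
have S0 : S !=set0 by exists x; split; rewrite /= ?in_itv/= ?lexx ?ltW.
have [a [Sa amax]] : exists a, S a /\ forall s, S s -> s <= a.
  have [|a aS aM] := @compact_EVT_max R R id S S0 cS.
    by apply: continuous_subspaceT => s; exact: cvg_id.
  by exists a; split; [exact/set_mem|move=> s Ss; apply: aM; exact/mem_set].
have [/= axy Fa] := Sa; move: axy; rewrite in_itv/= => /andP[xa ay].
have pos s : a < s <= y -> 0 < F s.
  move=> /andP[as_ sy]; rewrite ltNge; apply/negP => Fs.
  have : s <= a.
    apply: amax; split => //=; rewrite in_itv/= sy andbT.
    by rewrite (le_trans xa)// ltW.
  by rewrite leNgt as_.
have a_y : a < y by rewrite lt_neqAle ay andbT; apply/eqP => E; move: Fa; rewrite E leNgt Fy.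
(* If [F a < 0], then [F] would remain negative slightly to the right of [a], where it is
   positive. *)
have Fa0 : F a = 0.
  apply/eqP; rewrite eq_le Fa/= leNgt; apply/negP => Fa'.
  have : \forall s \near a, F s < 0.
    by have := cF a; move=> /cvgr_lt; exact.
  move=> /nbhs_ballP[d /= d0 dP].
  pose s := a + Num.min (d / 2) (y - a).
  have ms : 0 < Num.min (d / 2) (y - a) by rewrite lt_min; apply/andP; split; lra.
  have s1 : Num.min (d / 2) (y - a) <= d / 2 by rewrite ge_min lexx.
  have s2 : Num.min (d / 2) (y - a) <= y - a by rewrite ge_min lexx orbT.
  have Fs : F s < 0.
    by apply: dP; rewrite /ball/= /s opprD addrA subrr sub0r normrN gtr0_norm//; lra.
  have ps : 0 < F s by apply: pos; rewrite /s; apply/andP; split; lra.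
  by rewrite ltNge (ltW Fs) in ps.
exists a; split => //; rewrite a_y andbT lt_neqAle xa andbT.
by apply/eqP => E; move: Fx; rewrite E Fa0 ltxx.
Qed.

(** The right end is [last_zero] applied to the reflected function [s -> F (- s)]. *)
Lemma positive_component (F : R -> R) (x t y : R) : continuous F -> x < t -> t < y ->
  F x < 0 -> 0 < F t -> F y < 0 ->
  exists a b, [/\ x < a < t, t < b < y, F a = 0, F b = 0 &
    forall s, a < s < b -> 0 < F s].
Proof.
move=> cF xt ty Fx Ft Fy.
have [a [xat Fa apos]] := last_zero cF xt Fx Ft.
have cG : continuous (F \o -%R).
  by move=> s; apply: continuous_comp; [exact: opp_continuous|exact: cF].
have [| | |b [ybt Fb bpos]] := @last_zero (F \o -%R) (- y) (- t) cG.
- by rewrite ltrN2.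
- by rewrite /= opprK.
- by rewrite /= opprK.
exists a, (- b); split => //; first by move: ybt; lra.
move=> s /andP[as_ sb]; have [st|ts] := leP s t; first by apply: apos; rewrite as_.
by have := bpos (- s); rewrite /= opprK; apply; lra.
Qed.

Variable r : R.
Hypothesis r0 : 0 < r.

Lemma L2fun_restrict (h : R -> R) (a b : R) : L2fun r h ->
  L2fun r (fun s => if a < s < b then h s else 0).
Proof.
move=> [mh h0 h2].
have mH : measurable_fun [set: R] (fun s => if a < s < b then h s else 0).
  apply: measurable_fun_ifT => //.
  by apply: measurable_and; exact: measurable_fun_ltr.
split => // [t tr|]; first by rewrite h0// if_same.
apply: le_lt_trans h2; apply: ge0_le_integral => //.
- by move=> t _; rewrite lee_fin sqr_ge0.
- by apply/measurable_EFinP; exact: measurable_funX.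
- by apply/measurable_EFinP; exact: measurable_funX.
- by move=> t _; rewrite lee_fin; case: ifP => // _; rewrite expr0n/= sqr_ge0.
Qed.

Lemma L2fun_bounded (k : R -> R) (M : R) : measurable_fun [set: R] k ->
  (forall t, ~~ (0 < t < r) -> k t = 0) -> (forall t, `|k t| <= M) -> L2fun r k.
Proof.
move=> mk k0 kM; split => //.
apply: (@le_lt_trans _ _ (\int[mu]_(t in `]0%R, r[) (M ^+ 2)%:E)%E).
  rewrite [leRHS]integral_mkcond; apply: ge0_le_integral => //.
  - by move=> t _; rewrite lee_fin sqr_ge0.
  - by apply/measurable_EFinP; exact: measurable_funX.
  - by apply/(measurable_restrictT _ _).1 => //; exact: measurable_cst.
  move=> t _; rewrite patchE mem_setE in_itv/=; case: ifPn => tr; last first.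
    by rewrite k0// expr0n.
  rewrite lee_fin -[k t ^+ 2]real_normK ?num_real// lerXn2r// ?nnegrE//.
  exact: le_trans (kM t).
rewrite integral_cst//= lebesgue_measure_itv/= lte_fin r0 -EFinB -EFinM.
by rewrite ltry.
Qed.

Variables (h c c' : R -> R) (a b : R).
Hypotheses (Lh : L2fun r h) (a0 : 0 < a) (ab : a < b) (br : b < r).
Hypothesis dc : forall s : R, 0 < s -> is_derive s (1 : R) c (c' s).
Hypothesis cc' : forall s : R, 0 < s -> {for s, continuous c'}.
Hypotheses (ha : prim h a = c a) (hb : prim h b = c b).

(** The derivative of [prim h - c] cut down to [(a, b)]. The hypotheses on [c] concern [s > 0] only,
    because the barrier blows up at the origin. *)
Let H s := if a < s < b then h s - c' s else 0.

Let cc'_ab : {within `[a, b], continuous c'}.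
Proof.
apply: continuous_in_subspaceT => s /set_mem; rewrite /= in_itv/= => /andP[as_ _].
by apply: cc'; exact: lt_le_trans as_.
Qed.

Let mc' : measurable_fun [set: R] (fun s => if a < s < b then c' s else 0).
Proof.
have -> : (fun s => if a < s < b then c' s else 0) = c' \_ `]a, b[.
  by apply/funext => s; rewrite patchE mem_setE in_itv.
apply/(measurable_restrictT _ _).1 => //.
have := subspace_continuous_measurable_fun (measurable_itv `[a, b]) cc'_ab.
by apply: measurable_funS => //; exact: subset_itv_oo_cc.
Qed.

(** As [a > 0], the function [c'] is continuous on the compact interval [[a, b]], hence bounded
    there. *)
Lemma L2fun_truncation : L2fun r H.
Proof.
have [M [_ cM]] : bounded_set (c' @` `[a, b]%classic).
  by apply: compact_bounded; apply: continuous_compact => //; exact: segment_compact.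
have Lc : L2fun r (fun s => if a < s < b then c' s else 0).
  apply: (@L2fun_bounded _ (`|M| + 1)) => // t.
    move=> tr; case: ifPn => // /andP[at_ tb]; exfalso; move/negP: tr; apply.
    apply/andP; split; [exact: lt_trans a0 at_|exact: lt_trans tb br].
  case: ifP => [/andP[at_ tb]|_]; last by rewrite normr0 addr_ge0.
  apply: (cM (`|M| + 1)); first by rewrite (le_lt_trans (ler_norm M))// ltrDl.
  by exists t => //=; rewrite in_itv/= !ltW.
have := L2funB (L2fun_restrict a b Lh) Lc.
have -> // : (fun t => (if a < t < b then h t else 0) - (if a < t < b then c' t else 0)) = H.
by apply/funext => s; rewrite /H; case: ifP => // _; rewrite subr0.
Qed.

(** The truncation has no jumps because [prim h] and [c] agree at [a] and [b]. Going leftwards: zero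
    from [b] on, then the fundamental theorem down to [a], where the value is zero again, and
    constant before [a]. *)
Lemma prim_truncation t : prim H t = if a < t < b then prim h t - c t else 0.
Proof.
have LH := L2fun_truncation.
have Hb s : b <= s -> prim H s = 0.
  move=> bs; rewrite /prim /Rintegral integral0_eq ?oppr0// => u.
  rewrite /= in_itv/= andbT => su; rewrite /H ifF//.
  by apply/negP => /andP[_ ub]; have := lt_le_trans ub bs; rewrite ltNge (ltW su).
have Hab s : a <= s -> s < b -> prim H s = prim h s - c s.
  move=> as_ sb.
  have E1 := prim_sub LH (ltW sb); have E2 := prim_sub Lh (ltW sb).
  have ic : mu.-integrable `[s, b] (EFin \o c').
    apply: continuous_compact_integrable; first exact: segment_compact.
    by apply: continuous_subspaceW cc'_ab; apply: subset_itvr; rewrite bnd_simp.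
  have FTC : \int[mu]_(u in `]s, b]) c' u = c b - c s.
    rewrite Rintegral_itv_obnd_cbnd; last first.
      by apply: integrableS ic => //; exact: subset_itv_oc_cc.
    have s0 : 0 < s by exact: lt_le_trans as_.
    have dcc u : 0 < u -> {for u, continuous c}.
      move=> u0; apply: differentiable_continuous; apply/derivable1_diffP.
      by have [] := dc u0.
    rewrite /Rintegral (@continuous_FTC2 _ c' c)//.
    - by apply: continuous_subspaceW cc'_ab; apply: subset_itvr; rewrite bnd_simp.
    - split => [u||].
      + by rewrite in_itv/= => /andP[su _]; have [] := dc (lt_trans s0 su).
      + by apply: cvg_at_right_filter; exact: dcc.
      + by apply: cvg_at_left_filter; apply: dcc; exact: lt_trans sb.
    - move=> u; rewrite in_itv/= => /andP[su _].
      by rewrite derive1E; have [_ ->] := dc (lt_trans s0 su).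
  have ih : mu.-integrable `]s, b] (EFin \o h).
    exact: integrableS (L2fun_integrable Lh).
  have ic' : mu.-integrable `]s, b] (EFin \o c').
    by apply: integrableS ic => //; exact: subset_itv_oc_cc.
  have iH : mu.-integrable `]s, b] (EFin \o H).
    exact: integrableS (L2fun_integrable LH).
  have ihc : mu.-integrable `]s, b] (EFin \o (fun u => h u - c' u)).
    by apply: (integrableB _ ih ic').
  have E3 : \int[mu]_(u in `]s, b]) H u = \int[mu]_(u in `]s, b]) (h u - c' u).
    have sub : `]s, b[%classic `<=` `]s, b]%classic by exact: subset_itv_oo_oc.
    rewrite -!Rintegral_itv_bndo_bndc; [|exact: integrableS ihc|exact: integrableS iH].
    apply: eq_Rintegral => u; rewrite mem_setE in_itv/= => /andP[su ub].
    by rewrite /H (le_lt_trans as_ su) ub.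
  move: E1; rewrite E3 RintegralB// -E2 FTC (Hb b (lexx b)) hb; lra.
have [bt|tb] := leP b t; first by rewrite andbF Hb.
have [at_|ta] /= := ltP a t; first by rewrite Hab// ltW.
have E := prim_sub LH ta.
have I0 : \int[mu]_(x in `]t, a]) H x = 0.
  rewrite /Rintegral integral0_eq// => u; rewrite /= in_itv/= => /andP[_ ua].
  by rewrite /H ltNge ua.
by move: E; rewrite I0 Hab// ha subrr sub0r => /eqP; rewrite oppr_eq0 => /eqP.
Qed.

End truncation.

(** * Square integrable functions and the exchange inequality *)

Section L2_functions.
Context d (T : measurableType d) (R : realType) (m : {measure set T -> \bar R}).
Variables (D : set T) (mD : measurable D).

Lemma L2_integrable_sqr (f : T -> R) : L2 m D f ->
  m.-integrable D (EFin \o (fun x => f x ^+ 2)).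
Proof.
move=> [mf f2]; apply/integrableP; split.
  by apply/measurable_EFinP; exact: measurable_funX.
apply: le_lt_trans f2; rewrite le_eqVlt; apply/orP; left; apply/eqP.
by apply: eq_integral => x _; rewrite /comp abse_EFin ger0_norm// sqr_ge0.
Qed.

Lemma L2N (f : T -> R) : L2 m D f -> L2 m D (fun x => - f x).
Proof.
move=> [mf f2]; split; first exact: measurable_funN.
by under eq_integral do rewrite sqrrN.
Qed.

Lemma L2B (f g : T -> R) : L2 m D f -> L2 m D g -> L2 m D (fun x => f x - g x).
Proof.
move=> Lf Lg; have [mf _] := Lf; have [mg _] := Lg.
split; first exact: measurable_funB.
have If : m.-integrable D (fun x => 2%:E * (f x ^+ 2)%:E)%E.
  by apply: integrableZl => //; exact: L2_integrable_sqr.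
have Ig : m.-integrable D (fun x => 2%:E * (g x ^+ 2)%:E)%E.
  by apply: integrableZl => //; exact: L2_integrable_sqr.
have /integrableP[_] := integrableD mD If Ig; apply: le_lt_trans.
apply: ge0_le_integral => //.
- by move=> x _; rewrite lee_fin sqr_ge0.
- by apply/measurable_EFinP; apply: measurable_funX; exact: measurable_funB.
- apply: measurableT_comp => //; apply: emeasurable_funD.
    by case/integrableP : If.
  by case/integrableP : Ig.
move=> x _; apply: le_trans (lee_abs _); rewrite -!EFinM -EFinD lee_fin.
by have := sqr_ge0 (f x + g x); nra.
Qed.

Lemma L2D (f g : T -> R) : L2 m D f -> L2 m D g -> L2 m D (fun x => f x + g x).
Proof.
move=> Lf Lg; have := L2B Lf (L2N Lg).
by congr (L2 _ _ _); apply/funext => x; rewrite opprK.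
Qed.

(** Add the two inequalities and use [p^2 + q^2 = (p - e)^2 + (q + e)^2 + 2 w]. *)
Lemma sum_minimizers_le0 (p q e w : T -> R) : L2 m D p -> L2 m D q -> L2 m D e ->
  m.-integrable D (EFin \o w) ->
  (forall x, D x -> e x * (p x - q x - e x) = w x) ->
  (\int[m]_(x in D) (p x ^+ 2)%:E <= \int[m]_(x in D) ((p x - e x) ^+ 2)%:E)%E ->
  (\int[m]_(x in D) (q x ^+ 2)%:E <= \int[m]_(x in D) ((q x + e x) ^+ 2)%:E)%E ->
  \int[m]_(x in D) w x <= 0.
Proof.
move=> Lp Lq Le Iw ew minp minq.
have Ip := L2_integrable_sqr Lp; have Iq := L2_integrable_sqr Lq.
have Ipe := L2_integrable_sqr (L2B Lp Le).
have Iqe := L2_integrable_sqr (L2D Lq Le).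
have lep : \int[m]_(x in D) (p x ^+ 2) <= \int[m]_(x in D) ((p x - e x) ^+ 2).
  by apply: fine_le => //; exact: integrable_fin_num.
have leq : \int[m]_(x in D) (q x ^+ 2) <= \int[m]_(x in D) ((q x + e x) ^+ 2).
  by apply: fine_le => //; exact: integrable_fin_num.
have I1 : m.-integrable D (EFin \o (fun x => p x ^+ 2 + q x ^+ 2)).
  exact: (integrableD mD Ip Iq).
have I2 : m.-integrable D (EFin \o (fun x => (p x - e x) ^+ 2 + (q x + e x) ^+ 2)).
  exact: (integrableD mD Ipe Iqe).
have I3 : m.-integrable D (EFin \o (fun x => 2 * w x)).
  exact: (integrableZl mD 2 Iw).
have : \int[m]_(x in D) (p x ^+ 2 + q x ^+ 2) =
    \int[m]_(x in D) ((p x - e x) ^+ 2 + (q x + e x) ^+ 2 + 2 * w x).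
  by apply: eq_Rintegral => x /set_mem Dx; rewrite -ew//; ring.
rewrite RintegralD//.
have -> := RintegralD mD I2 I3; rewrite RintegralD// RintegralZl// => E.
by lra.
Qed.

Lemma Rintegral_posneg (f : T -> R) : m.-integrable D (EFin \o f) ->
  \int[m]_(x in D) f x = \int[m]_(x in D) (Num.max (f x) 0) -
                         \int[m]_(x in D) (Num.max (- f x) 0).
Proof.
move=> If.
have fp := integrable_fin_num mD (integrable_funepos mD If).
have fn := integrable_fin_num mD (integrable_funeneg mD If).
rewrite {1}/Rintegral integralE fineB//; congr (fine _ - fine _).
  by apply: eq_integral => x _; rewrite funeposE /= EFin_max.
by apply: eq_integral => x _; rewrite funenegE /= EFin_max.
Qed.

End L2_functions.

Section radial_Rintegral.
Context {R : realType}.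
Local Notation mu := (@lebesgue_measure R).
Variables (r : R) (m : nat).
Hypothesis r0 : 0 < r.
Local Notation lr := (@lebesgue_rV R m.+2).

(** Signed version of [radial_integral]: the same constant serves the positive part, the negative
    part and the absolute value, the last one giving integrability. *)
Lemma radial_Rintegral : exists2 k : R, 0 < k & forall G : R -> R,
  measurable_fun [set: R] G -> G 0 = 0 ->
  mu.-integrable `]0, r[ (EFin \o (fun s => s ^+ m.+1 * G s)) ->
  lr.-integrable (eball r) (EFin \o (fun x => G (enorm x))) /\
  \int[lr]_(x in eball r) G (enorm x) =
  k * \int[mu]_(s in `]0, r[) (s ^+ m.+1 * G s).
Proof.
have [k k0 radial] := @radial_integral R m.+1; exists k => // G mG G0 IG.
have part (o : R -> R) : measurable_fun [set: R] o -> (forall t, 0 <= o t) ->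
    (forall c t, 0 <= c -> o (c * t) = c * o t) ->
    (\int[lr]_(x in eball r) (o (G (enorm x)))%:E =
     k%:E * \int[mu]_(s in `]0%R, r[) (o (s ^+ m.+1 * G s))%:E)%E.
  move=> mo o0 oM; have o00 : o 0 = 0 by have := oM 0 0 (lexx 0); rewrite !mul0r.
  pose H s : \bar R := (if s < r then o (G s) else 0)%:E.
  have mH : measurable_fun setT H.
    apply/measurable_EFinP; apply: measurable_fun_ifT => //.
      exact: measurable_fun_ltr.
    exact: measurableT_comp.
  have H0 s : (0 <= H s)%E by rewrite /H lee_fin; case: ifP.
  have H00 : H 0 = 0%E by rewrite /H G0 o00 if_same.
  have E := radial H mH H0 H00.
  transitivity (\int[lr]_x H (enorm x))%E.
    rewrite integral_mkcond; apply: eq_integral => x _.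
    rewrite patchE /H; have [xr|xr] := ltP (enorm x) r; first by rewrite mem_set.
    by rewrite memNset//; apply/negP; rewrite -leNgt.
  rewrite E [in RHS]integral_mkcond; congr (_ * _)%E; apply: eq_integral => s _.
  rewrite patchE mem_setE in_itv/= /H -EFinM.
  have [s0|s0] := ltP 0 s => /=; last by rewrite mul0r.
  have [sr|sr] := ltP s r; last by rewrite mulr0.
  by rewrite oM// exprn_ge0// ltW.
have mop : measurable_fun [set: R] (fun t : R => Num.max t 0) by exact: measurable_maxr.
have mon : measurable_fun [set: R] (fun t : R => Num.max (- t) 0).
  by apply: measurable_maxr => //; exact: oppr_measurable.
have Ep := part _ mop (fun t => ltac:(by rewrite le_max lexx orbT))
  (fun c t c0 => ltac:(by rewrite maxr_pMr// mulr0)).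
have En := part _ mon (fun t => ltac:(by rewrite le_max lexx orbT))
  (fun c t c0 => ltac:(by rewrite maxr_pMr// mulr0 mulrN)).
have En' := part (fun t : R => `|t|) (@normr_measurable R setT) (@normr_ge0 _ _)
  (fun c t c0 => ltac:(by rewrite /= normrM ger0_norm)).
have IGr : lr.-integrable (eball r) (EFin \o (fun x => G (enorm x))).
  apply/integrableP; split.
    apply/measurable_EFinP; apply: measurable_funTS.
    by apply: (measurableT_comp mG); exact: measurable_enorm.
  rewrite [X in (X < _)%E]En'; apply: lte_mul_pinfty => //; first by rewrite lee_fin ltW.
  by case/integrableP : IG.
split => //.
have Ip : mu.-integrable `]0, r[ (EFin \o (fun s => Num.max (s ^+ m.+1 * G s) 0)).
  by apply: (integrable_funrpos _ IG).
have In : mu.-integrable `]0, r[ (EFin \o (fun s => Num.max (- (s ^+ m.+1 * G s)) 0)).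
  by apply: (integrable_funrneg _ IG).
rewrite Rintegral_posneg//; last exact: measurable_eball.
rewrite [in RHS]Rintegral_posneg//.
rewrite mulrBr /Rintegral Ep En !fineM//.
  exact: integrable_fin_num In.
exact: integrable_fin_num Ip.
Qed.

End radial_Rintegral.

(** * Profiles supported away from the origin *)

Section bumps.
Context {R : realType}.
Local Notation mu := (@lebesgue_measure R).
Variables (r : R) (m : nat).
Hypothesis r0 : 0 < r.
Local Notation lr := (@lebesgue_rV R m.+2).

Variables (H : R -> R) (a b : R).
Hypotheses (LH : L2fun r H) (a0 : 0 < a) (br : b < r).
Hypothesis H_out : forall s, ~~ (a < s < b) -> prim H s = 0.

Let cp : continuous (prim H). Proof. exact: prim_continuous LH. Qed.

(** On the support [s > a], so [1/s] is at most [1/a]. *)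
Let bounded_quot : exists M, forall s, `|prim H s / s| <= M.
Proof.
have [M hM] := prim_bounded LH; exists (M * a^-1) => s.
have M0 : 0 <= M by apply: le_trans (hM 0).
have [/andP[as_ sb]|sab] := boolP (a < s < b); last first.
  by rewrite H_out// mul0r normr0 mulr_ge0// invr_ge0 ltW.
have s0 := lt_trans a0 as_.
rewrite normrM normfV (gtr0_norm s0); apply: ler_pM => //.
  by rewrite invr_ge0 ltW.
by rewrite lef_pV2 ?posrE// ltW.
Qed.

Let L2_quot : L2fun r (fun s => - (m.+1%:R * (prim H s / s))).
Proof.
have [M hM] := bounded_quot.
apply: (@L2fun_bounded _ r r0 _ (m.+1%:R * M)).
- apply: measurable_funN; apply: measurable_funM => //; apply: measurable_funM.
    exact: continuous_measurable_fun.
  exact: measurable_invr.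
- move=> s sr; rewrite H_out ?mul0r ?mulr0 ?oppr0//.
  apply: contra sr => /andP[as_ sb].
  by rewrite (lt_trans a0 as_) (lt_trans sb br).
- by move=> s; rewrite normrN normrM ger0_norm// ler_wpM2l.
Qed.

Lemma L2fun_radial_profile : L2fun r (fun s => H s + m.+1%:R * (prim H s / s)).
Proof.
have := L2funB LH L2_quot.
by congr (L2fun _ _); apply/funext => s; rewrite opprK.
Qed.

Let mE : measurable_fun [set: R] (fun s => H s + m.+1%:R * (prim H s / s)).
Proof. by case: L2fun_radial_profile. Qed.

(** This relies on the support being away from the origin: in dimension two, a profile that is
    nonzero at [0] has a divergence which is not square integrable. *)
Lemma L2_radial_div : L2 lr (eball r) (radial_div H).
Proof.
split; first by apply: measurable_funTS; exact: measurable_radial_div LH.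
have [_ E0 E2] := L2fun_radial_profile.
apply: (@radial_integral_lty _ _ r
  (fun s => (H s + m.+1%:R * (prim H s / s)) ^+ 2)).
- exact: measurable_funX.
- by move=> s; exact: sqr_ge0.
- by rewrite E0 ?expr0n// ltxx.
have I : mu.-integrable setT (fun s => (r ^+ m.+1)%:E *
    ((H s + m.+1%:R * (prim H s / s)) ^+ 2)%:E)%E.
  apply: integrableZl => //; apply/integrableP; split.
    by apply/measurable_EFinP; exact: measurable_funX.
  by under eq_integral do rewrite gee0_abs ?lee_fin ?sqr_ge0//.
have /integrableP[_] : mu.-integrable `]0, r[ (fun s => (r ^+ m.+1)%:E *
    ((H s + m.+1%:R * (prim H s / s)) ^+ 2)%:E)%E by exact: integrableS I.
apply: le_lt_trans; apply: ge0_le_integral => //.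
- move=> s; rewrite /= in_itv/= => /andP[s0 _].
  by rewrite lee_fin mulr_ge0 ?sqr_ge0// exprn_ge0// ltW.
- apply/measurable_EFinP; apply: measurable_funTS; apply: measurable_funM => //.
  exact: measurable_funX.
- apply: measurableT_comp => //; apply/measurable_EFinP; apply: measurable_funTS.
  by apply: measurable_funM => //; exact: measurable_funX.
move=> s sI; apply: le_trans (lee_abs _).
move: sI; rewrite /= in_itv/= => /andP[s0 sr]; rewrite -EFinM lee_fin ler_wpM2r ?sqr_ge0//.
by rewrite lerXn2r// ?nnegrE ltW.
Qed.

Lemma integrable_flux :
  mu.-integrable `]0, r[ (EFin \o (fun s => s ^+ m * (H s + m.+1%:R * (prim H s / s)))).
Proof.
have [M hM] := continuous_bounded_itv 0 r (@exprn_continuous R m).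
have me : measurable_fun [set: R] (fun s : R => s ^+ m) by exact: exprn_measurable.
have I : mu.-integrable setT (EFin \o (fun s => (H s + m.+1%:R * (prim H s / s)) * s ^+ m)).
  apply: (integrable_mul_bounded L2fun_radial_profile me (M := M)) => s /andP[s0 sr].
  by apply: hM; rewrite !ltW.
have {}I : mu.-integrable `]0, r[
    (EFin \o (fun s => (H s + m.+1%:R * (prim H s / s)) * s ^+ m)).
  exact: integrableS I.
by apply: eq_integrable I => // s _; rewrite /comp mulrC.
Qed.

(** Integrating [s^m H] by parts produces [- m s^(m-1) prim H], so of the coefficient [m+1] exactly
    one unit remains: the integral equals that of [s^m * (prim H / s)], which is positive. *)
Lemma flux_gt0 t : 0 < t < r -> (forall s, 0 <= prim H s) -> 0 < prim H t ->
  0 < \int[mu]_(s in `]0, r[) (s ^+ m * (H s + m.+1%:R * (prim H s / s))).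
Proof.
move=> tr H0 Ht.
have dz s : derivable (fun s : R => s ^+ m) s 1 by exact: exprn_derivable.
have z'E : derive1 (fun s : R => s ^+ m) = fun s => m%:R * s ^+ m.-1.
  by apply/funext => s; rewrite exp_derive1.
have cz : continuous (derive1 (fun s : R => s ^+ m)).
  by rewrite z'E => s; apply: cvgM; [exact: cvg_cst|exact: exprn_continuous].
have P := prim_by_parts r0 LH dz cz.
rewrite (H_out (s := 0)) ?mul0r ?oppr0 ?add0r in P; last first.
  by rewrite ltNge (ltW a0).
have Ic : mu.-integrable `]0, r[ (EFin \o (fun s => prim H s * derive1 (fun s => s ^+ m) s)).
  by apply: continuous_integrable_itv => s; apply: cvgM; [exact: cp|exact: cz].
have IH : mu.-integrable `]0, r[ (EFin \o (fun s => H s * s ^+ m)).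
  have [M hM] := continuous_bounded_itv 0 r (@exprn_continuous R m).
  have me : measurable_fun [set: R] (fun s : R => s ^+ m) by exact: exprn_measurable.
  have I : mu.-integrable setT (EFin \o (fun s => H s * s ^+ m)).
    apply: (integrable_mul_bounded LH me (M := M)) => s /andP[s0 sr].
    by apply: hM; rewrite !ltW.
  exact: integrableS I.
have Iq : mu.-integrable `]0, r[ (EFin \o (fun s => s ^+ m * (prim H s / s))).
  have [M hM] := bounded_quot; have [B hB] := continuous_bounded_itv 0 r (@exprn_continuous R m).
  pose A : set R := `]0, r[%classic.
  have fA : (mu A < +oo)%E.
    by rewrite lebesgue_measure_itv/= lte_fin r0 -EFinB ltry.
  apply: measurable_bounded_integrable; [by []|exact: fA| |].
  - apply: measurable_funTS; apply: measurable_funM => //; apply: measurable_funM.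
      exact: continuous_measurable_fun.
    exact: measurable_invr.
  - exists (B * M); split; first exact: num_real.
    move=> y BMy s; rewrite /= in_itv/= => /andP[s0 sr].
    by rewrite normrM (le_trans _ (ltW BMy))// ler_pM// hB// !ltW.
(* Bounding [1/s] below by [1/r] gives an integrand continuous on the whole line, as
   [continuous_integral_gt0] requires. *)
have If := continuous_integrable_itv 0 r (F := fun s => prim H s * s ^+ m * r^-1).
apply: (@lt_le_trans _ _ (\int[mu]_(s in `]0, r[) (prim H s * s ^+ m * r^-1))).
  apply: (@continuous_integral_gt0 _ _ _ _ t) => //.
  - move=> s; apply: cvgM; last exact: cvg_cst.
    by apply: cvgM; [exact: cp|exact: exprn_continuous].
  - move=> s; have [/andP[as_ _]|sab] := boolP (a < s < b); last by rewrite H_out// !mul0r.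
    rewrite !mulr_ge0//; last by rewrite invr_ge0 ltW.
    by rewrite exprn_ge0// ltW// (lt_trans a0).
  - move: tr => /andP[t0 tr]; rewrite !mulr_gt0 ?invr_gt0//.
    exact: exprn_gt0.
have -> : \int[mu]_(s in `]0, r[) (s ^+ m * (H s + m.+1%:R * (prim H s / s))) =
    \int[mu]_(s in `]0, r[) (s ^+ m * (prim H s / s)).
  transitivity (\int[mu]_(s in `]0, r[) (H s * s ^+ m +
     (prim H s * derive1 (fun s => s ^+ m) s + s ^+ m * (prim H s / s)))).
    apply: eq_Rintegral => s; rewrite mem_setE in_itv/= => /andP[s0 _].
    (* For [m = 0] the truncated predecessor is harmless, as both sides are zero. *)
    have mE' : m%:R * s ^+ m.-1 = m%:R * (s ^+ m / s) :> R.
      case: (m) => [|k]; first by rewrite !mul0r.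
      by rewrite exprSr mulfK// gt_eqF.
    rewrite z'E mE' mulrDr mulrC; congr (_ + _).
    by rewrite -natr1; ring.
  have I2 : mu.-integrable `]0, r[ (EFin \o (fun s =>
      prim H s * derive1 (fun s => s ^+ m) s + s ^+ m * (prim H s / s))).
    by apply: (integrableD _ Ic Iq).
  by rewrite RintegralD// RintegralD// P addrA subrr add0r.
apply: le_Rintegral => //.
  apply: If => s; apply: cvgM; last exact: cvg_cst.
  by apply: cvgM; [exact: cp|exact: exprn_continuous].
move=> s; rewrite /= in_itv/= => /andP[s0 sr].
rewrite -mulrA mulrCA; apply: ler_wpM2l; first by rewrite exprn_ge0// ltW.
apply: ler_wpM2l => //.
by rewrite lef_pV2 ?posrE// ltW.
Qed.

End bumps.

(** Two of the bounds come from [w >= 0], the other two from [p - w >= q + (nu - lam)] and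
    [q + w <= p - (nu - lam)]. *)
Lemma transfer_bounds (R : realDomainType) (p q w lam nu : R) :
  `|p| <= nu -> `|q| <= lam -> lam <= nu -> 0 <= w -> w <= p - q - (nu - lam) ->
  `|p - w| <= nu /\ `|q + w| <= lam.
Proof.
rewrite !ler_norml => /andP[p1 p2] /andP[q1 q2] ln w0 wle.
by split; apply/andP; split; lra.
Qed.

(** * The barrier and the exchange argument *)

Section comparison.
Context {R : realType}.
Local Notation mu := (@lebesgue_measure R).
Variables (r : R) (m : nat).
Hypothesis r0 : 0 < r.
Local Notation lr := (@lebesgue_rV R m.+2).

(** In dimension [m+2], the term in [e] is, up to a factor, the radial derivative of the fundamental
    solution of the Laplacian. *)
Definition barrier (c0 e s : R) : R := c0 + e * (s ^+ m.+1)^-1.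

Definition barrier' (e s : R) : R :=
  e * (- (s ^+ m.+1) ^- 2 * (m.+1%:R * s ^+ m)).

Lemma is_derive_barrier (c0 e s : R) : 0 < s ->
  is_derive s (1 : R) (barrier c0 e) (barrier' e s).
Proof.
move=> s0.
have D1 : is_derive s (1 : R) (fun t => t ^+ m.+1) (m.+1%:R * s ^+ m).
  by apply: DeriveDef; [exact: exprn_derivable|rewrite exp_derive scaler1].
have n0 : s ^+ m.+1 != 0 by rewrite expf_neq0// gt_eqF.
have D2 := @is_deriveV R (fun t => t ^+ m.+1) s _ 1 n0 D1.
have D3 := is_deriveZ e D2.
have D4 := is_deriveD (is_derive_cst c0 s 1) D3.
by apply: (is_derive_eq D4); rewrite add0r.
Qed.

Lemma continuous_barrier' (e s : R) : 0 < s -> {for s, continuous (barrier' e)}.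
Proof.
move=> s0; have n0 : s ^+ m.+1 != 0 by rewrite expf_neq0// gt_eqF.
apply: cvgM; first exact: cvg_cst.
apply: cvgM; last by apply: cvgM; [exact: cvg_cst|exact: exprn_continuous].
apply: cvgN; apply: cvgV; first by rewrite expf_neq0.
have c1 : {for s, continuous (fun t : R => t ^+ m.+1)} by exact: exprn_continuous.
exact: (cvgM c1 c1).
Qed.

Lemma barrier_div (c0 e s : R) : 0 < s ->
  barrier' e s + m.+1%:R * (barrier c0 e s / s) = m.+1%:R * c0 / s.
Proof.
move=> s0; rewrite /barrier' /barrier (exprS s m).
have : s ^+ m != 0 by rewrite expf_neq0// gt_eqF.
move: (s ^+ m) (m.+1%:R : R) => u n u0.
by field; rewrite u0 gt_eqF.
Qed.

Lemma radial_divB n h k x : L2fun r h -> L2fun r k ->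
  @radial_div R n (fun s => h s - k s) x = radial_div h x - radial_div k x.
Proof. by move=> Lh Lk; rewrite /radial_div (primB _ Lh Lk); ring. Qed.

Lemma radial_divN n h x : L2fun r h ->
  @radial_div R n (fun s => - h s) x = - radial_div h x.
Proof. by move=> Lh; rewrite /radial_div (primN _ Lh); ring. Qed.

Definition profile_minimizer (lam : R) (g : 'rV[R]_m.+2 -> R) (h : R -> R) : Prop :=
  [/\ L2fun r h, forall t, 0 < t < r -> `|prim h t| <= lam &
   forall k, L2fun r k -> (forall t, 0 < t < r -> `|prim k t| <= lam) ->
      (\int[lr]_(x in eball r) ((radial_div h x + g x) ^+ 2)%:E <=
       \int[lr]_(x in eball r) ((radial_div k x + g x) ^+ 2)%:E)%E].

(** The energy is even in the pair of field and datum, and the constraint is symmetric; this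
    supplies the lower half of the comparison. *)
Lemma profile_minimizerN lam g h : profile_minimizer lam g h ->
  profile_minimizer lam (fun x => - g x) (fun s => - h s).
Proof.
move=> [Lh hlam hmin]; split.
- exact: L2funN.
- by move=> t tr; rewrite (primN _ Lh) normrN hlam.
move=> k Lk klam; have LNk := L2funN Lk.
have := hmin _ LNk; have E (f : R -> R) : L2fun r f ->
    (\int[lr]_(x in eball r) ((radial_div (fun s => - f s) x - g x) ^+ 2)%:E =
     \int[lr]_(x in eball r) ((radial_div f x + g x) ^+ 2)%:E)%E.
  move=> Lf; apply: eq_integral => x _; rewrite radial_divN//.
  by congr EFin; rewrite -opprD sqrrN.
have NN : (fun s => - - k s) = k by apply/funext => s; rewrite opprK.
rewrite (E _ Lh) -(E _ LNk) NN; apply => t tr.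
by rewrite (primN _ Lk) normrN klam.
Qed.

(** Square integrability is not automatic for a profile near the origin; it comes from minimality,
    by comparison with the zero field, whose energy is that of [g]. *)
Lemma L2_profile lam g h : 0 <= lam -> L2 lr (eball r) g ->
  profile_minimizer lam g h -> L2 lr (eball r) (fun x => radial_div h x + g x).
Proof.
move=> lam0 [mg g2] [Lh hlam hmin]; split.
  apply: measurable_funD => //; apply: measurable_funTS.
  exact: measurable_radial_div Lh.
apply: le_lt_trans g2; have := hmin _ (L2fun0 r).
under [X in (_ -> (_ <= X)%E) -> _]eq_integral => x _.
  rewrite /radial_div prim0 mul0r mulr0 addr0 add0r; over.
by apply => t _; rewrite prim0 normr0.
Qed.

Lemma profile_comparison (g : 'rV[R]_m.+2 -> R) (lam nu : R) (hp hq : R -> R) :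
  L2 lr (eball r) g -> 0 <= lam -> lam < nu ->
  profile_minimizer nu g hp -> profile_minimizer lam g hq ->
  forall t, 0 < t < r -> prim hp t - prim hq t <= nu - lam.
Proof.
move=> Lg lam0 lamnu Mp Mq t /andP[t0 tr].
have nu0 : 0 <= nu by rewrite (le_trans lam0)// ltW.
have Lp2 := L2_profile nu0 Lg Mp; have Lq2 := L2_profile lam0 Lg Mq.
have [Lp pnu pmin] := Mp; have [Lq qlam qmin] := Mq.
rewrite leNgt; apply/negP => tgt.
pose c0 := nu - lam; have c00 : 0 < c0 by rewrite subr_gt0.
pose h s := hp s - hq s; have Lh : L2fun r h by exact: L2funB.
have hE s : prim h s = prim hp s - prim hq s by exact: primB Lp Lq.
(* Half of the weighted excess at [t], so that [F t = e] is still positive. *)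
pose e : R := t ^+ m.+1 * (prim h t - c0) / 2.
have e0 : 0 < e.
  by rewrite /e divr_gt0// mulr_gt0 ?exprn_gt0// subr_gt0 hE.
(* The excess over the barrier multiplied by [s^(m+1)]: this clears the singularity, and [F] is
   continuous on the line with [F 0 = - e]. *)
pose F s := s ^+ m.+1 * (prim h s - c0) - e.
have cF : continuous F.
  move=> s; apply: cvgB; last exact: cvg_cst.
  apply: cvgM; first exact: exprn_continuous.
  by apply: cvgB; [apply: (prim_continuous Lh)|exact: cvg_cst].
have F0 : F 0 < 0 by rewrite /F expr0n/= mul0r sub0r oppr_lt0.
have Ft : 0 < F t by have := e0; rewrite /F /e; lra.
have Fr : F r < 0.
  rewrite /F (prim_ge_r Lh (lexx r)) sub0r mulrN -opprD oppr_lt0.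
  by rewrite addr_gt0// mulr_gt0// exprn_gt0.
have [a [b [/andP[a0 at_] /andP[tb br] Fa Fb Fpos]]] := positive_component cF t0 tr F0 Ft Fr.
have ab : a < b by exact: lt_trans tb.
have FE (s : R) : 0 < s -> F s = s ^+ m.+1 * (prim h s - barrier c0 e s).
  move=> s0; have n0 : s ^+ m.+1 != 0 by rewrite expf_neq0// gt_eqF.
  rewrite /F /barrier; move: (s ^+ m.+1) n0 => u u0.
  by field.
have Fz (s : R) : 0 < s -> F s = 0 -> prim h s = barrier c0 e s.
  move=> s0; rewrite FE// => /eqP; rewrite mulf_eq0 expf_eq0 (gt_eqF s0) andbF/=.
  by rewrite subr_eq0 => /eqP.
have ha := Fz a a0 Fa.
have hb := Fz b (lt_trans a0 ab) Fb.
pose H s := if a < s < b then h s - barrier' e s else 0.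
have LH : L2fun r H.
  exact: (@L2fun_truncation _ r r0 h (barrier' e) a b Lh a0 br (@continuous_barrier' e)).
have HE : forall s, prim H s = if a < s < b then prim h s - barrier c0 e s else 0.
  exact: (@prim_truncation _ r r0 h (barrier c0 e) (barrier' e) a b Lh a0 ab br
    (@is_derive_barrier c0 e) (@continuous_barrier' e) ha hb).
have Hout s : ~~ (a < s < b) -> prim H s = 0 by move=> sab; rewrite HE (negbTE sab).
have Hpos s : a < s < b -> 0 < prim H s.
  move=> sab; have s0 : 0 < s by case/andP : sab => as_ _; exact: lt_trans as_.
  by have := Fpos s sab; rewrite FE// pmulr_rgt0 ?exprn_gt0// HE sab.
have Hge0 s : 0 <= prim H s.
  by have [/Hpos/ltW//|/Hout ->] := boolP (a < s < b).
have Hle s : a < s < b -> prim H s <= prim hp s - prim hq s - c0.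
  move=> sab; have s0 : 0 < s by case/andP : sab => as_ _; exact: lt_trans as_.
  rewrite HE sab hE /barrier opprD addrA lerBlDr lerDl mulr_ge0 ?ltW//.
  by rewrite invr_gt0 exprn_gt0.
pose k1 s := hp s - H s; have Lk1 : L2fun r k1 by exact: L2funB.
(* The sum is written as a difference so that the lemmas on differences apply. *)
pose k2 s := hq s - (- H s); have LNH := L2funN LH.
have Lk2 : L2fun r k2 by exact: L2funB.
have k1nu s : 0 < s < r -> `|prim k1 s| <= nu.
  move=> sr; rewrite /k1 (primB _ Lp LH).
  have [sab|/Hout ->] := boolP (a < s < b); last by rewrite subr0 pnu.
  by have [] := transfer_bounds (pnu s sr) (qlam s sr) (ltW lamnu) (Hge0 s) (Hle s sab).
have k2lam s : 0 < s < r -> `|prim k2 s| <= lam.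
  move=> sr; rewrite /k2 (primB _ Lq LNH) (primN _ LH) opprK.
  have [sab|/Hout ->] := boolP (a < s < b); last by rewrite addr0 qlam.
  by have [] := transfer_bounds (pnu s sr) (qlam s sr) (ltW lamnu) (Hge0 s) (Hle s sab).
have minp := pmin _ Lk1 k1nu; have minq := qmin _ Lk2 k2lam.
have Le := L2_radial_div m r0 LH a0 br Hout.
have [kk kk0 radial] := @radial_Rintegral R r m.
pose E s := H s + m.+1%:R * (prim H s / s).
pose W s := E s * (m.+1%:R * c0 / s).
have IW : mu.-integrable `]0, r[ (EFin \o (fun s => s ^+ m.+1 * W s)).
  have IE : mu.-integrable `]0, r[ (EFin \o (fun s => m.+1%:R * c0 * (s ^+ m * E s))).
    exact: (integrableZl _ (m.+1%:R * c0) (integrable_flux m r0 LH a0 br Hout)).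
  apply: eq_integrable IE => // s; rewrite mem_setE in_itv/= => /andP[s0 _].
  by rewrite /W exprSr; congr EFin; field; rewrite gt_eqF.
have mW : measurable_fun [set: R] W.
  have [mE _ _] := L2fun_radial_profile m r0 LH a0 br Hout.
  by apply: measurable_funM => //; apply: measurable_funM => //; exact: measurable_invr.
have W0 : W 0 = 0 by rewrite /W invr0 !mulr0.
have [IWb WE] := radial W mW W0 IW.
(* The datum [g] cancels. Outside [(a, b)] both sides vanish; inside, [barrier_div] leaves the
   divergence of the constant profile [c0]. *)
have pointwise x : eball r x -> radial_div H x *
    ((radial_div hp x + g x) - (radial_div hq x + g x) - radial_div H x) = W (enorm x).
  move=> _; rewrite /radial_div /= -/(E (enorm x)) /W.
  move: (enorm x) (g x) => s y; have [sab|sab] := boolP (a < s < b); last first.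
    by rewrite /E /H (negbTE sab) -/H Hout// mul0r mulr0 addr0 !mul0r.
  have s0 : 0 < s by case/andP : sab => as_ _; exact: lt_trans as_.
  congr (_ * _); rewrite -(barrier_div c0 e s0) {1}/E /H sab -/H HE sab hE /h; ring.
have Wle : \int[lr]_(x in eball r) W (enorm x) <= 0.
  apply: (sum_minimizers_le0 (measurable_eball r) Lp2 Lq2 Le IWb pointwise).
    apply: (le_trans minp); rewrite le_eqVlt; apply/orP; left; apply/eqP.
    by apply: eq_integral => x _; rewrite (radial_divB _ Lp LH) addrAC.
  apply: (le_trans minq); rewrite le_eqVlt; apply/orP; left; apply/eqP.
  by apply: eq_integral => x _; rewrite (radial_divB _ Lq LNH) (radial_divN _ LH) opprK addrAC.
have tr' : 0 < t < r by rewrite t0.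
have fl := flux_gt0 m r0 LH a0 Hout tr' Hge0 (Hpos t ltac:(by rewrite at_)).
move: Wle; rewrite WE leNgt => /negP; apply; rewrite mulr_gt0//.
(* The factor [1/s] in [W] lowers the weight from [s^(m+1)] to [s^m], which is the flux integral of
   [flux_gt0]. *)
have -> : \int[mu]_(s in `]0, r[) (s ^+ m.+1 * W s) =
    m.+1%:R * c0 * \int[mu]_(s in `]0, r[) (s ^+ m * E s).
  have IE := integrable_flux m r0 LH a0 br Hout.
  rewrite -RintegralZl//; apply: eq_Rintegral => s; rewrite mem_setE in_itv/= => /andP[s0 _].
  by rewrite /W exprSr; field; rewrite gt_eqF.
by rewrite !mulr_gt0.
Qed.

End comparison.

Lemma enorm_radial_field (R : realType) n (h : R -> R) (x : 'rV[R]_n) : x != 0 ->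
  enorm (radial_field h x) = `|prim h (enorm x)|.
Proof.
move=> x0; have ex : 0 < enorm x by rewrite enorm_gt0.
by rewrite /radial_field !enormZ normfV (gtr0_norm ex) mulVf ?mulr1// gt_eqF.
Qed.

Theorem theorem4p9 (R : realType) (N : nat) (r : R) (g : 'rV[R]_N -> R)
    (hN : (2 <= N)%N) (hr : 0 < r)
    (hgL2 : L2 (lebesgue_rV N) (eball r) g) (hgrad : radial (eball r) g)
    (lam mu : R) (hlam : 0 <= lam) (hmu : lam < mu)
    (z_lam z_mu : 'rV[R]_N -> 'rV[R]_N)
    (hz_lam : dual_minimizer r g lam z_lam)
    (hz_mu : dual_minimizer r g mu z_mu) :
  [set x | [/\ eball r x, x != 0 & enorm (z_lam x) < lam]] `<=`
  [set x | [/\ eball r x, x != 0 & enorm (z_mu x) < mu]].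
Proof.
case: N hN g hgL2 hgrad z_lam z_mu hz_lam hz_mu => [|[|m]]// _ g Lg _ zl zm Ml Mm.
have [mg _] := Lg.
have [hl [Ll bl zlE minl]] := dual_minimizer_prim hr mg Ml.
have [hm [Lm bm zmE minm]] := dual_minimizer_prim hr mg Mm.
have Pl : profile_minimizer r lam g hl by split.
have Pm : profile_minimizer r mu g hm by split.
move=> x [rx x0]; rewrite zlE// enorm_radial_field// => zlx; split => //.
rewrite zmE// enorm_radial_field//.
have tr : 0 < enorm x < r by rewrite enorm_gt0// x0.
have up := profile_comparison hr Lg hlam hmu Pm Pl tr.
(* The opposite inequality, from the problem with datum [- g]. *)
have := profile_comparison hr (L2N Lg) hlam hmu
  (profile_minimizerN Pm) (profile_minimizerN Pl) tr.
rewrite (primN _ Lm) (primN _ Ll) => low.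
by move: zlx; rewrite !ltr_norml => /andP[? ?]; apply/andP; split; lra.
Qed.
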